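(* In the setting described in the context (in particular, the functions $\{g[u_k]\}_{k=1}^{n_0}\subset L^2(\mathcal{X}\times\mathcal{S})$ are uniformly bounded, $C_g:=\max_{1\le k\le n_0}\sup_{x\in\mathcal{X},s\in\mathcal{S}}|g[u_k](x,s)|<\infty$), the following hold. (a) The function $\overline{G}(s,s')$ is in $L^2_{\rho\otimes\rho}(\mathcal{S}\times\mathcal{S})$ and symmetric, and the operator $\mathcal{L}_{\overline{G}}:L^2_\rho\to L^2_\rho$ defined by $$\mathcal{L}_{\overline{G}}\phi(s):=\int_{\mathcal{S}}\phi(s')\,\overline{G}(s,s')\,\rho(ds')$$ is compact, self-adjoint, and positive (i.e. $\langle\mathcal{L}_{\overline{G}}\phi,\phi\rangle_{L^2_\rho}\ge 0$ for all $\phi\in L^2_\rho$). Hence its eigenvalues $\{\lambda_i\}_{i\ge1}$ are nonnegative and its orthonormal eigenfunctions $\{\psi_i\}_i$ form a complete basis of $L^2_\rho$. (b) The loss function $\mathcal{E}_{\mathcal{D}}$ can be written, for $\phi\in L^2_\rho$, as $$\mathcal{E}_{\mathcal{D}}(\phi)=\langle\mathcal{L}_{\overline{G}}\phi,\phi\rangle_{L^2_\rho}-2\langle\phi^D,\phi\rangle_{L^2_\rho}+\mathrm{const},$$ where the constant does not depend on $\phi$ and $\phi^D\in L^2_\rho$ is the Riesz representer determined by $\langle\phi^D,\phi\rangle_{L^2_\rho}=\frac1{n_0}\sum_{k=1}^{n_0}\langle R_\phi[u_k],f_k\rangle_{\mathbb{Y}}$ for all $\phi\in L^2_\rho$. In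 particular, when the data is noiseless (i.e. $f_k(x_j)=R_{\phi_*}[u_k](x_j)$ for all $k,j$, with true kernel $\phi_*\in L^2_\rho$), one has $\phi^D=\mathcal{L}_{\overline{G}}\phi_*$, and $\mathcal{E}_{\mathcal{D}}$ has a unique minimizer $\widehat\phi=\mathcal{L}_{\overline{G}}^{-1}\phi^D=P_H(\phi_* )$ in $$H:=\overline{\mathrm{span}\{\psi_i\}_{i:\lambda_i>0}}=\mathcal{N}(\mathcal{L}_{\overline{G}})^\perp\subset L^2_\rho .$$ (c) The RKHS of $\overline{G}$ is $H_{\overline{G}}:=\mathcal{L}_{\overline{G}}^{1/2}(L^2_\rho)$ with inner product determined by $\langle\phi,\phi\rangle_{H_{\overline{G}}}=\langle\mathcal{L}_{\overline{G}}^{-1/2}\phi,\mathcal{L}_{\overline{G}}^{-1/2}\phi\rangle_{L^2_\rho}$. Moreover $H=\overline{H_{\overline{G}}}$, with closure taken in $L^2_\rho$, and $\langle\phi,\mathcal{L}_{\overline{G}}\psi\rangle_{H_{\overline{G}}}=\langle\phi,\psi\rangle_{L^2_\rho}$ for any $\phi\in H_{\overline{G}}$ and $\psi\in L^2_\rho$.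
   Context: Setting. $\mathcal{S}=[0,1]$ with Lebesgue measure; $\mathcal{X}=\{x_j\}_{j=1}^J\subset[0,1]$ is a uniform mesh with mesh size $\Delta x=1/J$, equipped with the atomic measure $\nu(\{x_j\})=1/J$; $\mathbb{Y}=L^2_\nu(\mathcal{X})$. For given inputs $u_1,\dots,u_{n_0}$ the real-valued functions $g[u_k](x,s)$, $(x,s)\in\mathcal{X}\times\mathcal{S}$, are given (measurable in $s$). For a kernel $\phi$, $$R_\phi[u_k](x)=\int_{\mathcal{S}}\phi(s)\,g[u_k](x,s)\,ds,\qquad x\in\mathcal{X}.$$ The output data are $f_k(x_j)=R_{\phi_*}[u_k](x_j)+\epsilon_k(x_j)$ with $\phi_*$ the true kernel and $\epsilon_k(x_j)$ noise. The loss function is $$\mathcal{E}_{\mathcal{D}}(\phi)=\frac1{n_0}\sum_{k=1}^{n_0}\sum_{j=1}^{J}|R_\phi[u_k](x_j)-f_k(x_j)|^2\,\Delta x .$$ Exploration measure. $\rho$ is the measure on $\mathcal{S}$ with density with respect to Lebesgue measure $\dot\rho(s)=\frac{1}{n_0Z}\sum_{k=1}^{n_0}\int_{\mathcal{X}}|g[u_k](x,s)|\,\nu(dx)$, where $Z=\frac1{n_0}\sum_{k=1}^{n_0}\int_{\mathcal{S}}\int_{\mathcal{X}}|g[u_k](x,s)|\,\nu(dx)\,ds$ is the normalization constant (assumed positive). Write $L^2_\rho=L^2_\rho(\mathcal{S})$; elements are classes of functions equal $\rho$-a.e. Automatic reproducing kernel. $$G(s,s')=\frac1{n_0}\sum_{k=1}^{n_0}\int_{\mathcal{X}}g[u_k](x,s)g[u_k](x,s')\,\nu(dx),\qquad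 \overline{G}(s,s')=\frac{G(s,s')}{\dot\rho(s)\dot\rho(s')}\mathbf{1}_{\{\dot\rho(s)\dot\rho(s')>0\}}.$$ Conventions. $\mathcal{N}(\cdot)$ denotes the null space, $P_H$ the orthogonal projection in $L^2_\rho$ onto $H$. $\mathcal{L}_{\overline{G}}^{-1}$ and $\mathcal{L}_{\overline{G}}^{-1/2}$ denote inverses of the restrictions of $\mathcal{L}_{\overline{G}}$, $\mathcal{L}_{\overline{G}}^{1/2}$ to $H=\mathcal{N}(\mathcal{L}_{\overline{G}})^\perp$, defined on the respective ranges. The RKHS (reproducing kernel Hilbert space) of $\overline{G}$ is regarded as a space of $\rho$-a.e. equivalence classes, i.e. as the image in $L^2_\rho$ (with quotient norm) of the RKHS of functions on $\mathcal{S}$ with reproducing kernel $\overline{G}$. *)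

(* Defs.v *)
From HB Require Import structures.
From mathcomp Require Import all_boot all_order all_algebra.
From mathcomp Require Import all_classical all_reals all_analysis.

Set Implicit Arguments.
Unset Strict Implicit.
Unset Printing Implicit Defensive.

Import Order.TTheory GRing.Theory Num.Theory.
Import numFieldNormedType.Exports.

Local Open Scope classical_set_scope.
Local Open Scope ring_scope.

(* The space L^2_mu is handled through square-integrable functions: an element
   of L^2_mu is a function [f \in Lfun mu 2%:E], and equality in L^2_mu is
   [f = g %[ae mu]].  A subset of L^2_mu is a set of such functions; all the
   sets of the form [L2_closure _], [null_space _], [L2_orth _],
   [L2_range _] and [rkhs_image _] below are saturated for a.e. equality, so
   that equality of sets is equality of subsets of L^2_mu. *)
Section L2.
Context d (T : measurableType d) (R : realType).
Variable mu : {measure set T -> \bar R}.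
Implicit Types (f h : T -> R) (A H : set (T -> R)) (L M : (T -> R) -> T -> R).

Definition L2 : set (T -> R) := [set f | f \in Lfun mu 2%:E].

Definition L2_dot f h : R := \int[mu]_s (f s * h s).

Definition L2_norm f : R := fine ('N[mu]_2%:E[EFin \o f]).

Definition L2_cvg (F : nat -> T -> R) h :=
  (fun n => L2_norm (F n - h)) @ \oo --> (0 : R).

Definition L2_closure A : set (T -> R) :=
  [set f | L2 f /\
     forall e : R, 0 < e -> exists2 a, A a & L2_norm (f - a) < e].

Definition lin_span A : set (T -> R) :=
  [set f | exists n (c : 'I_n -> R) (a : 'I_n -> T -> R),
     (forall i, A (a i)) /\ f = \sum_(i < n) c i *: a i].

Definition L2_orth A : set (T -> R) :=
  [set f | L2 f /\ forall a, A a -> L2_dot f a = 0].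

Definition orth_proj_of H f p :=
  H p /\ forall h, H h -> L2_dot (f - p) h = 0.

Record bounded_operator L : Prop := {
  bounded_operator_L2 : forall f, L2 f -> L2 (L f) ;
  bounded_operator_linear : forall (c : R) f h, L2 f -> L2 h ->
    L (c *: f + h) = c *: L f + L h %[ae mu] ;
  bounded_operator_bounded :
    exists C : R, forall f, L2 f -> L2_norm (L f) <= C * L2_norm f }.

Definition compact_operator L :=
  forall F : nat -> T -> R, (forall n, L2 (F n)) ->
    (exists C : R, forall n, L2_norm (F n) <= C) ->
    exists e : nat -> nat, {homo e : m n / (m < n)%N} /\
      exists2 h, L2 h & L2_cvg (fun n => L (F (e n))) h.

Definition self_adjoint L :=
  forall f h, L2 f -> L2 h -> L2_dot (L f) h = L2_dot f (L h).

Definition positive_operator L := forall f, L2 f -> 0 <= L2_dot (L f) f.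

Definition null_space L : set (T -> R) :=
  [set f | L2 f /\ L f = (0 : T -> R) %[ae mu]].

Definition L2_range L : set (T -> R) :=
  [set f | L2 f /\ exists2 h, L2 h & f = L h %[ae mu]].

(* [M] is the nonnegative square root L^{1/2}. *)
Record sqrt_operator L M : Prop := {
  sqrt_operator_bounded : bounded_operator M ;
  sqrt_operator_self_adjoint : self_adjoint M ;
  sqrt_operator_positive : positive_operator M ;
  sqrt_operator_sqr : forall f, L2 f -> M (M f) = L f %[ae mu] }.

(* [f] is in the range of the restriction of [L] to [H] and [h] is its (only)
   preimage under this restriction, that is, h = (L|_H)^{-1} f. *)
Definition restr_inverse L H f h :=
  [/\ H h, L h = f %[ae mu] &
      forall h', H h' -> L h' = f %[ae mu] -> h' = h %[ae mu]].

Record eigenbasis L (lam : nat -> R) (psi : nat -> T -> R) : Prop := {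
  eigenbasis_L2 : forall i, L2 (psi i) ;
  eigenbasis_eigen : forall i, L (psi i) = lam i *: psi i %[ae mu] ;
  eigenbasis_orthonormal : forall i j,
    L2_dot (psi i) (psi j) = (i == j)%:R ;
  eigenbasis_complete : forall f, L2 f ->
    L2_cvg (fun n => \sum_(i < n) L2_dot f (psi i) *: psi i) f }.

End L2.

(* [V] with inner product [ip] is the Hilbert space of functions on [D] with
   reproducing kernel [K].  A function on [D] is represented by its extension
   by 0 to [T]. *)
Record is_rkhs (T : Type) (R : realType) (D : set T) (K : T -> T -> R)
    (V : set (T -> R)) (ip : (T -> R) -> (T -> R) -> R) : Prop := {
  rkhs_supp : forall F, V F -> forall t, ~ D t -> F t = 0 ;
  rkhs_zero : V 0 ;
  rkhs_closed : forall (c : R) F E, V F -> V E -> V (c *: F + E) ;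
  rkhs_sym : forall F E, V F -> V E -> ip F E = ip E F ;
  rkhs_linear : forall (c : R) F E P, V F -> V E -> V P ->
    ip (c *: F + E) P = c * ip F P + ip E P ;
  rkhs_ge0 : forall F, V F -> 0 <= ip F F ;
  rkhs_eq0 : forall F, V F -> ip F F = 0 -> F = 0 ;
  rkhs_complete : forall F : nat -> T -> R, (forall n, V (F n)) ->
    (forall e : R, 0 < e -> exists N : nat, forall m n : nat,
       (N <= m)%N -> (N <= n)%N ->
       Num.sqrt (ip (F m - F n) (F m - F n)) < e) ->
    exists2 E, V E &
      (fun n => Num.sqrt (ip (F n - E) (F n - E))) @ \oo --> (0 : R) ;
  rkhs_kernel : forall t, D t -> V (K t) ;
  rkhs_reproducing : forall F t, V F -> D t -> ip F (K t) = F t }.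

(* A space of functions [V] with inner product [ip] (an RKHS below), regarded
   as a space of classes for a.e. equality, with the quotient norm. *)
Section RKHS_classes.
Context d (T : measurableType d) (R : realType).
Variable mu : {measure set T -> \bar R}.
Variables (V : set (T -> R)) (ip : (T -> R) -> (T -> R) -> R).

Definition rkhs_image : set (T -> R) :=
  [set f | L2 mu f /\ exists2 F, V F & f = F %[ae mu]].

Definition quot_norm (f : T -> R) : R :=
  inf [set r | exists F, [/\ V F, f = F %[ae mu] & r = Num.sqrt (ip F F)]].

(* the inner product determined by the quotient norm (polarization) *)
Definition quot_dot (f h : T -> R) : R :=
  (quot_norm (f + h) ^+ 2 - quot_norm (f - h) ^+ 2) / 4.

End RKHS_classes.

Definition unitI (R : realType) : set R := `[0, 1].
Arguments unitI R : clear implicits.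

Section Setting.
Context (R : realType) (J n0 : nat) (U : Type).
Variables (x : 'I_J -> R) (u : 'I_n0 -> U) (g : U -> R -> R -> R).

Definition uniform_mesh :=
  (forall j, unitI R (x j)) /\ forall i j, x j - x i = (j%:R - i%:R) / J%:R.

(* the integral of [h] over the mesh for the atomic measure nu({x_j}) = 1/J *)
Definition mesh_int (h : R -> R) : R := \sum_(j < J) h (x j) * J%:R^-1.

Definition avg (a : 'I_n0 -> R) : R := n0%:R^-1 * \sum_(k < n0) a k.

(* R_phi[v](y) *)
Definition Rop (phi : R -> R) (v : U) (y : R) : R :=
  \int[lebesgue_measure]_(s in unitI R) (phi s * g v y s).

Definition loss (f : 'I_n0 -> R -> R) (phi : R -> R) : R :=
  avg (fun k => mesh_int (fun y => `|Rop phi (u k) y - f k y| ^+ 2)).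

Definition normZ : R :=
  avg (fun k => \int[lebesgue_measure]_(s in unitI R)
                  mesh_int (fun y => `|g (u k) y s|)).

(* The density of rho, extended by 0 outside of [0, 1]; thus the measure rho on
   [0, 1] is seen as a measure on R carried by [0, 1]. *)
Definition rho_density (s : R) : R :=
  \1_(unitI R) s * (normZ^-1 * avg (fun k => mesh_int (fun y => `|g (u k) y s|))).

Definition G (s s' : R) : R :=
  avg (fun k => mesh_int (fun y => g (u k) y s * g (u k) y s')).

Definition Gbar (s s' : R) : R :=
  if 0 < rho_density s * rho_density s'
  then G s s' / (rho_density s * rho_density s') else 0.

Definition LG (rho : {measure set (measurableTypeR R) -> \bar R})
    (phi : R -> R) (s : R) : R :=
  \int[rho]_s' (phi s' * Gbar s s').

Definition riesz_representer (rho : {measure set (measurableTypeR R) -> \bar R})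
    (f : 'I_n0 -> R -> R) (phiD : R -> R) :=
  L2 rho phiD /\ forall phi, L2 rho phi ->
    L2_dot rho phiD phi =
    avg (fun k => mesh_int (fun y => Rop phi (u k) y * f k y)).

End Setting.

(* Main.v *)
Require Import Defs.
From HB Require Import structures.
From mathcomp Require Import all_boot all_order all_algebra.
From mathcomp Require Import all_classical all_reals all_analysis.
From mathcomp Require Import measurable_realfun ring lra.

Set Implicit Arguments.
Unset Strict Implicit.
Unset Printing Implicit Defensive.

Import Order.TTheory GRing.Theory Num.Theory.
Import numFieldNormedType.Exports.

Local Open Scope classical_set_scope.
Local Open Scope ring_scope.

(** Only finitely many functions g[u_k](x_j, .) enter the problem, so the kernel
    has finite rank.  Put w^2 = 1 / (n0 J) and let a_(k,j) be the quotient of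
    w g[u_k](x_j, .) by the density of rho; then Gbar (s, s') is the sum of the
    a_i(s) a_i(s') at every pair of points.  The density is a multiple of the
    average of the |g[u_k](x_j, .)|, hence dominates each of them up to a constant,
    and the features a_i are bounded.  What remains is the geometry of a finite
    family in L^2_rho.

    An orthogonal matrix applied to the family (a_i) changes neither the kernel nor
    the operator, and this freedom is used twice ([kernel_decomposition]).
    Diagonalizing the Gram matrix makes the family orthogonal in L^2_rho; taking
    as few functions as possible makes it linearly independent as a family of
    functions on [0, 1].  Call the result (b_p) and write lam_p = <b_p, b_p>, which
    may be 0 because independence is pointwise while norms see only classes.

    Orthogonality gives everything about the operator, L f being the sum of the
    <f, b_p> b_p.  Operators f |-> sum of c_p <f, b_p> b_p compose by
    (c, e) |-> (c_p lam_p e_p), so L, its square root, the projection onto H and the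
    inverses are all of this form, with c_p a power of lam_p; the convention
    0^-1 = 0 handles the null b_p.  Compactness is the Bolzano-Weierstrass theorem
    for the finitely many coordinates.  A nonnegative square root of L must
    multiply b_p by the square root of lam_p and kill the orthogonal complement of
    the b_p, so there is only one ([sqrt_unique]).

    Pointwise independence gives everything about the reproducing kernel space: in
    any Hilbert space of functions with kernel Gbar the b_p form an orthonormal
    basis ([rkhs_combP], [rkhs_ip_comb]).  The quotient norm of the class of
    the sum of the c_p b_p is then obtained by dropping the c_p with lam_p = 0, and
    the result is the norm of the preimage under the square root
    ([rkhs_classes_sqrt]).

    A complete orthonormal sequence of eigenfunctions is found by normalizing the
    non-null b_p and continuing with Gram-Schmidt on the indicators of the rays with
    rational end point; whatever is orthogonal to the b_p is in the null space of L.
    The rays are total by a Dynkin class argument.  The process never stops because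
    rho is bounded by a multiple M of the Lebesgue measure: n orthonormal functions
    cannot span the indicators of m intervals of length 1 / m as soon as m exceeds
    n M / rho (]0, 1]) ([L2_infinite_dim]).

    Finally, integrating against the density turns R_phi[u_k](x_j) into
    w^-1 <phi, a_(k,j)> ([Rop_feature]).  The loss is thus a sum of squares of affine
    functions of the coordinates of phi, whose linear part is the Riesz representer;
    without noise it is the sum of the squares of the <phi - phistar, b_p> up to a
    constant, which on H is minimal exactly at the projection of phistar
    ([quadratic_minimizer]). *)

(** * Geometry of square-integrable functions *)

Section L2_geometry.
Context d (T : measurableType d) (R : realType).
Variable mu : {measure set T -> \bar R}.
Implicit Types (f g h : T -> R).
Local Notation L2 := (L2 mu).
Local Notation "<< f , g >>" := (L2_dot mu f g).

Let two1 : (1 <= 2%:E :> \bar R)%E.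
Proof. by rewrite lee_fin ler1n. Qed.

Lemma L2_0 : L2 0.
Proof. by have [] := Lfun_submod_closed mu two1. Qed.

Lemma L2_lin (c : R) f g : L2 f -> L2 g -> L2 (c *: f + g).
Proof. by move=> Lf Lg; have [_ /(_ c f g Lf Lg)] := Lfun_submod_closed mu two1. Qed.

Lemma L2D f g : L2 f -> L2 g -> L2 (f + g).
Proof. by move=> ? ?; rewrite -[f]scale1r; exact: L2_lin. Qed.

Lemma L2Z (c : R) f : L2 f -> L2 (c *: f).
Proof. by move=> ?; rewrite -[_ *: _]addr0; apply: L2_lin => //; exact: L2_0. Qed.

Lemma L2B f g : L2 f -> L2 g -> L2 (f - g).
Proof. by move=> ? ?; rewrite -scaleN1r addrC; exact: L2_lin. Qed.

Lemma L2_sum (I : Type) (r : seq I) (P : pred I) (F : I -> T -> R) :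
  (forall i, P i -> L2 (F i)) -> L2 (\sum_(i <- r | P i) F i).
Proof.
by move=> LF; elim/big_ind: _ => //; [exact: L2_0|exact: L2D].
Qed.

Lemma L2_measurable f : L2 f -> measurable_fun setT f.
Proof. by move=> /sub_Lfun_mfun; rewrite inE. Qed.

Lemma L2_integrableM f g : L2 f -> L2 g ->
  mu.-integrable setT (EFin \o (fun s => f s * g s)).
Proof. by move=> Lf Lg; apply/Lfun1_integrable; exact: Lfun2_mul_Lfun1. Qed.

Lemma L2_dotC f g : << f, g >> = << g, f >>.
Proof. by apply: eq_Rintegral => s _; rewrite mulrC. Qed.

Lemma L2_dot_linl (c : R) f g h : L2 f -> L2 g -> L2 h ->
  << c *: f + g, h >> = c * << f, h >> + << g, h >>.
Proof.
move=> Lf Lg Lh; rewrite /L2_dot.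
under eq_Rintegral do rewrite !fctE mulrDl.
rewrite RintegralD //; [|exact: (L2_integrableM (L2Z c Lf) Lh)|exact: L2_integrableM].
under eq_Rintegral do rewrite -scalerAl.
by rewrite (@RintegralZl _ _ _ mu)//; exact: L2_integrableM.
Qed.

Lemma L2_dotDl f g h : L2 f -> L2 g -> L2 h -> << f + g, h >> = << f, h >> + << g, h >>.
Proof. by move=> ? ? ?; rewrite -[f]scale1r L2_dot_linl// scale1r mul1r. Qed.

Lemma L2_dot0l f : << 0, f >> = 0.
Proof.
rewrite /L2_dot (@eq_Rintegral _ _ _ mu _ (cst 0)); first by rewrite Rintegral_cst// mul0r.
by move=> s _; exact: mul0r.
Qed.

Lemma L2_dotZl (c : R) f h : L2 f -> L2 h -> << c *: f, h >> = c * << f, h >>.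
Proof.
move=> Lf Lh; rewrite -[c *: f]addr0 L2_dot_linl ?L2_dot0l ?addr0//.
exact: L2_0.
Qed.

Lemma L2_dotBl f g h : L2 f -> L2 g -> L2 h -> << f - g, h >> = << f, h >> - << g, h >>.
Proof. by move=> ? ? ?; rewrite addrC -scaleN1r L2_dot_linl// mulN1r addrC. Qed.

Lemma L2_dot_suml (I : Type) (r : seq I) (P : pred I) (F : I -> T -> R) h :
  (forall i, P i -> L2 (F i)) -> L2 h ->
  << \sum_(i <- r | P i) F i, h >> = \sum_(i <- r | P i) << F i, h >>.
Proof.
move=> LF Lh.
elim: r => [|i r IH]; first by rewrite !big_nil L2_dot0l.
rewrite !big_cons; case: ifPn => // Pi.
by rewrite L2_dotDl ?IH//; [exact: LF|exact: L2_sum].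
Qed.

Lemma L2_dotDr f g h : L2 f -> L2 g -> L2 h -> << h, f + g >> = << h, f >> + << h, g >>.
Proof. by move=> *; rewrite ![<< h, _ >>]L2_dotC L2_dotDl. Qed.

Lemma L2_dotZr (c : R) f h : L2 f -> L2 h -> << h, c *: f >> = c * << h, f >>.
Proof. by move=> *; rewrite ![<< h, _ >>]L2_dotC L2_dotZl. Qed.

Lemma L2_dotBr f g h : L2 f -> L2 g -> L2 h -> << h, f - g >> = << h, f >> - << h, g >>.
Proof. by move=> *; rewrite ![<< h, _ >>]L2_dotC L2_dotBl. Qed.

Lemma L2_dot_ge0 f : 0 <= << f, f >>.
Proof. by apply: Rintegral_ge0 => s _; rewrite -expr2 sqr_ge0. Qed.

Lemma L2_norm_sqr f : L2 f -> L2_norm mu f ^+ 2 = << f, f >>.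
Proof.
move=> Lf.
rewrite -powR_mulrn ?fine_ge0 ?Lnorm_ge0//.
have Nf : ('N[mu]_2%:E[EFin \o f] \is a fin_num)%E.
  rewrite ge0_fin_numE ?Lnorm_ge0//; have /sub_Lfun_finLfun := Lf.
  by rewrite inE.
rewrite /L2_norm /L2_dot /Rintegral; apply: EFin_inj.
rewrite -poweR_EFin fineK// powR_Lnorm// fineK; last first.
  by apply: integrable_fin_num => //; exact: L2_integrableM.
apply: eq_integral => s _ /=; congr EFin.
by rewrite powR_mulrn// real_normK ?num_real// expr2.
Qed.

Lemma L2_norm_ge0 f : 0 <= L2_norm mu f.
Proof. by rewrite fine_ge0 ?Lnorm_ge0. Qed.

Lemma L2_normE f : L2 f -> L2_norm mu f = Num.sqrt << f, f >>.
Proof. by move=> Lf; rewrite -L2_norm_sqr// sqrtr_sqr ger0_norm ?L2_norm_ge0. Qed.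

Lemma ae_eq_L2_dot f f' g g' : L2 f -> L2 f' -> L2 g -> L2 g' ->
  f = f' %[ae mu] -> g = g' %[ae mu] -> << f, g >> = << f', g' >>.
Proof.
move=> Lf Lf' Lg Lg' ff' gg'; rewrite /L2_dot /Rintegral; congr fine.
apply: ae_eq_integral => //.
- by apply: measurable_int; exact: L2_integrableM Lf Lg.
- by apply: measurable_int; exact: L2_integrableM Lf' Lg'.
by apply: filterS2 ff' gg' => s /(_ I) -> /(_ I) ->.
Qed.

Lemma L2_dot_eq0 f : L2 f -> (<< f, f >> = 0 <-> f = (0 : T -> R) %[ae mu]).
Proof.
move=> Lf; split=> [f0|f0].
  have : (\int[mu]_s `|(f s * f s)%:E| = 0)%E.
    under eq_integral do rewrite gee0_abs ?lee_fin -?expr2 ?sqr_ge0//.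
    rewrite -[LHS]fineK; first by congr EFin.
    by apply: integrable_fin_num => //; exact: L2_integrableM.
  move/ae_eq_integral_abs => /(_ measurableT).
  have mff := measurable_int _ (L2_integrableM Lf Lf).
  move=> /(_ mff); apply: filterS => s /= /(_ I) [] /eqP.
  by rewrite mulf_eq0 orbb => /eqP.
by rewrite (ae_eq_L2_dot (f' := 0) (g' := 0))// ?L2_dot0l//; exact: L2_0.
Qed.

Lemma L2_ae_eqP f g : L2 f -> L2 g -> (<< f - g, f - g >> = 0 <-> f = g %[ae mu]).
Proof.
move=> Lf Lg; rewrite L2_dot_eq0; last exact: L2B.
split; apply: filterS => s /(_ I); rewrite !fctE => fg _.
  by apply/eqP; rewrite -subr_eq0; apply/eqP.
by apply/eqP; rewrite subr_eq0 fg.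
Qed.

Lemma ae_refl f : f = f %[ae mu]. Proof. exact: aeW. Qed.

Lemma ae_sym f g : f = g %[ae mu] -> g = f %[ae mu].
Proof. by apply: filterS => s fg /fg. Qed.

Lemma ae_trans f g h : f = g %[ae mu] -> g = h %[ae mu] -> f = h %[ae mu].
Proof. by apply: filterS2 => s fg gh Ts; rewrite fg// gh. Qed.

Lemma ae_lin (c : R) f f' g g' : f = f' %[ae mu] -> g = g' %[ae mu] ->
  c *: f + g = c *: f' + g' %[ae mu].
Proof. by apply: filterS2 => s ff gg Ts; rewrite !fctE ff// gg. Qed.

Lemma L2_dot_sqrB f g : L2 f -> L2 g ->
  << f - g, f - g >> = << f, f >> - 2 * << f, g >> + << g, g >>.
Proof.
move=> Lf Lg; rewrite L2_dotBl ?L2_dotBr//; last exact: L2B.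
by rewrite [<< g, f >>]L2_dotC; ring.
Qed.

Lemma L2_dot_sqrD f g : L2 f -> L2 g ->
  << f + g, f + g >> = << f, f >> + 2 * << f, g >> + << g, g >>.
Proof.
move=> Lf Lg; rewrite L2_dotDl ?L2_dotDr//; last exact: L2D.
by rewrite [<< g, f >>]L2_dotC; ring.
Qed.

Lemma L2_dot_null f g : L2 f -> L2 g -> << g, g >> = 0 -> << f, g >> = 0.
Proof.
move=> Lf Lg /(L2_dot_eq0 Lg) g0.
rewrite (ae_eq_L2_dot (f' := f) (g' := 0))//; last exact: ae_refl.
  by rewrite L2_dotC L2_dot0l.
exact: L2_0.
Qed.

Lemma L2_CauchySchwarz f g : L2 f -> L2 g -> << f, g >> ^+ 2 <= << f, f >> * << g, g >>.
Proof.
move=> Lf Lg; have [g0|g0] := eqVneq << g, g >> 0.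
  by rewrite (L2_dot_null Lf Lg g0) expr0n/= mulr_ge0// L2_dot_ge0.
have gp : 0 < << g, g >> by rewrite lt_def g0 L2_dot_ge0.
have := L2_dot_ge0 (f - (<< f, g >> / << g, g >>) *: g).
rewrite L2_dot_sqrB//; last exact: L2Z.
rewrite L2_dotZr// L2_dotZl ?L2_dotZr//; last exact: L2Z.
rewrite -(ler_pM2r gp) mul0r => h; rewrite -subr_ge0.
by apply: le_trans h _; rewrite le_eqVlt; apply/orP; left; apply/eqP; field.
Qed.

Lemma L2_minkowski f g : L2 f -> L2 g ->
  L2_norm mu (f + g) <= L2_norm mu f + L2_norm mu g.
Proof.
move=> Lf Lg; rewrite -(ler_pXn2r (n := 2))// ?nnegrE ?addr_ge0 ?L2_norm_ge0//.
rewrite sqrrD !L2_norm_sqr//; last exact: L2D.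
rewrite L2_dot_sqrD// lerD2r lerD2l -[leRHS]mulr_natl ler_pM2l//.
rewrite !L2_normE// -sqrtrM ?L2_dot_ge0//.
by rewrite (le_trans (ler_norm _))// -sqrtr_sqr ler_wsqrtr// L2_CauchySchwarz.
Qed.

Lemma L2_normZ (c : R) f : L2 f -> L2_norm mu (c *: f) = `|c| * L2_norm mu f.
Proof.
move=> Lf; rewrite !L2_normE//; last exact: L2Z.
rewrite L2_dotZl ?L2_dotZr//; last exact: L2Z.
by rewrite mulrA -expr2 sqrtrM ?sqr_ge0// sqrtr_sqr.
Qed.

End L2_geometry.

(** * Finite-rank kernels *)

Lemma cvg_sumr (R : realType) (I U : Type) (F : set_system U) {FF : Filter F}
    (r : seq I) (u : I -> U -> R) (l : I -> R) :
  (forall i, u i x @[x --> F] --> l i) ->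
  \sum_(i <- r) u i x @[x --> F] --> \sum_(i <- r) l i.
Proof. by move=> ul; apply: cvg_big => //; exact: add_continuous. Qed.

(** The reflection that exchanges the unit vector (c, g) with the last basis vector
    preserves the scalar product of (x, X) and (y, Y), and the last coordinate of
    the image of a vector is its scalar product with (c, g). *)
Lemma householder_sum (R : fieldType) N (c x y : 'I_N -> R) (g X Y : R) :
  1 - g != 0 -> \sum_i c i ^+ 2 = 1 - g ^+ 2 ->
  let bx := \sum_i c i * x i + g * X in
  let by_ := \sum_i c i * y i + g * Y in
  \sum_i x i * y i + X * Y =
  \sum_i (x i - c i / (1 - g) * (bx - X)) * (y i - c i / (1 - g) * (by_ - Y))
  + bx * by_.
Proof.
move=> g1 c1 bx by_.
set p := (bx - X) / (1 - g); set q := (by_ - Y) / (1 - g).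
rewrite [X in _ = X + _](eq_bigr (fun i => x i * y i - q * (c i * x i) - p * (c i * y i)
    + p * q * c i ^+ 2)); last first.
  by move=> i _; rewrite /p /q; ring.
rewrite big_split/= !sumrB -!mulr_sumr c1.
have -> : \sum_i c i * x i = bx - g * X by rewrite /bx addrK.
have -> : \sum_i c i * y i = by_ - g * Y by rewrite /by_ addrK.
by rewrite /p /q; field.
Qed.

Section combinations.
Context (T : Type) (R : realType).

Definition submod (S : set (T -> R)) :=
  S 0 /\ forall (c : R) f g, S f -> S g -> S (c *: f + g).

Lemma submodZ S (c : R) f : submod S -> S f -> S (c *: f).
Proof. by move=> [S0 Sl] Sf; rewrite -[_ *: _]addr0; exact: Sl. Qed.

Lemma submod_sum S (I : Type) (r : seq I) (P : pred I) (F : I -> T -> R) :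
  submod S -> (forall i, P i -> S (F i)) -> S (\sum_(i <- r | P i) F i).
Proof.
move=> [S0 Sl] LF; elim/big_ind: _ => // f g Sf Sg.
by rewrite -[f]scale1r; exact: Sl.
Qed.

Definition kernel_of N (b : 'I_N -> T -> R) s t := \sum_i b i s * b i t.

Definition append N (b : 'I_N -> T -> R) (f : T -> R) (i : 'I_N.+1) :=
  if unlift ord_max i is Some j then b j else f.

Lemma append_widen N (b : 'I_N -> T -> R) f i :
  append b f (widen_ord (leqnSn N) i) = b i.
Proof.
rewrite /append (_ : widen_ord _ i = lift ord_max i) ?liftK//.
by apply/val_inj; exact: esym (lift_max i).
Qed.

Lemma append_max N (b : 'I_N -> T -> R) f : append b f ord_max = f.
Proof. by rewrite /append unlift_none. Qed.

Lemma kernel_of_append N (b : 'I_N -> T -> R) f s t :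
  kernel_of (append b f) s t = kernel_of b s t + f s * f t.
Proof.
rewrite /kernel_of big_ord_recr/= append_max; congr +%R.
by apply: eq_bigr => i _; rewrite append_widen.
Qed.

Lemma ord_recrP N (i : 'I_N.+1) :
  i = ord_max \/ exists j, i = widen_ord (leqnSn N) j.
Proof.
have [j ->|->] := unliftP ord_max i; last by left.
by right; exists j; apply/val_inj; exact: lift_max.
Qed.

Definition comb N (c : 'I_N -> R) (a : 'I_N -> T -> R) := \sum_i c i *: a i.

Lemma combE N (c : 'I_N -> R) (a : 'I_N -> T -> R) s :
  comb c a s = \sum_i c i * a i s.
Proof. by rewrite /comb fct_sumE. Qed.

Lemma comb_submod S N (c : 'I_N -> R) (a : 'I_N -> T -> R) :
  submod S -> (forall i, S (a i)) -> S (comb c a).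
Proof. by move=> Ss Sa; apply: submod_sum => // i _; exact: submodZ. Qed.

(** The sign makes the denominator [1 - k * c ord_max] of the reflection positive. *)
Lemma unit_multiple N (c : 'I_N.+1 -> R) : (exists i, c i != 0) ->
  exists2 k : R, \sum_i (k * c i) ^+ 2 = 1 & k * c ord_max <= 0.
Proof.
move=> [i ci]; pose r := Num.sqrt (\sum_i c i ^+ 2).
have r0 : 0 < \sum_i c i ^+ 2.
  rewrite (bigD1 i)//= ltr_pwDl// ?sumr_ge0//.
  - by rewrite exprn_even_gt0.
  - by move=> *; rewrite sqr_ge0.
have rr : r ^+ 2 = \sum_i c i ^+ 2 by rewrite sqr_sqrtr// ltW.
have rgt0 : 0 < r by rewrite sqrtr_gt0.
have k1 (k : R) : k ^+ 2 = 1 -> \sum_i (k / r * c i) ^+ 2 = 1.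
  move=> k1; under eq_bigr do rewrite exprMn.
  by rewrite -mulr_sumr exprMn k1 exprVn rr mul1r mulVf// gt_eqF.
have [cm|cm] := leP (c ord_max) 0.
  exists (1 / r); first by rewrite k1// expr1n.
  by rewrite mul1r mulr_ge0_le0// invr_ge0 ltW.
exists (-1 / r); first by rewrite k1// sqrrN expr1n.
by rewrite mulN1r mulNr oppr_le0 mulr_ge0// ?invr_ge0 ltW.
Qed.

(** The rows of the reflection of [householder_sum]: the last one is [c], and [D]
    collects the others, which are orthogonal to it. *)
Lemma householder S N (a : 'I_N.+1 -> T -> R) (c : 'I_N.+1 -> R) :
  submod S -> (forall i, S (a i)) ->
  \sum_i c i ^+ 2 = 1 -> c ord_max <= 0 ->
  exists D : 'I_N -> 'I_N.+1 -> R,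
    (forall i, \sum_j D i j * c j = 0) /\
    forall s t, kernel_of a s t =
      kernel_of (append (fun i => comb (D i) a) (comb c a)) s t.
Proof.
move=> Ss Sa c1 cm.
set g := c ord_max.
have g1 : 1 - g != 0 by rewrite gt_eqF// subr_gt0 (le_lt_trans cm).
pose w := fun i : 'I_N => widen_ord (leqnSn N) i.
have c1' : \sum_i c (w i) ^+ 2 = 1 - g ^+ 2.
  by rewrite -c1 big_ord_recr/= addrK.
exists (fun i j => (j == w i)%:R - c (w i) / (1 - g) * (c j - (j == ord_max)%:R)).
have sumD i (z : 'I_N.+1 -> R) : \sum_j ((j == w i)%:R
    - c (w i) / (1 - g) * (c j - (j == ord_max)%:R)) * z j
  = z (w i) - c (w i) / (1 - g) * (\sum_j c j * z j - z ord_max).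
  have sel k : \sum_j (j == k)%:R * z j = z k.
    rewrite (bigD1 k)//= eqxx mul1r big1 ?addr0// => j /negPf ->.
    by rewrite mul0r.
  under eq_bigr => j _ do
    rewrite mulrBl -(mulrA (c (w i) / (1 - g))) (mulrBl (z j) (c j)).
  by rewrite sumrB -mulr_sumr sumrB !sel.
split=> [i|s t].
  rewrite sumD; under eq_bigr do rewrite -expr2.
  by rewrite c1 -/g divfK// subrr.
rewrite kernel_of_append /kernel_of big_ord_recr/=.
rewrite (householder_sum _ _ _ _ g1 c1'); congr +%R.
  apply: eq_bigr => i _; rewrite !combE !sumD.
  by rewrite 2![\sum_(j < N.+1) _]big_ord_recr/=.
by rewrite !combE 2![\sum_(j < N.+1) _]big_ord_recr.
Qed.

Lemma comb_lin N (k : R) (c e : 'I_N -> R) (a : 'I_N -> T -> R) :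
  k *: comb c a + comb e a = comb (fun i => k * c i + e i) a.
Proof.
rewrite /comb scaler_sumr -big_split; apply: eq_bigr => i _ /=.
by rewrite scalerDl scalerA.
Qed.

Definition lin_indep N (b : 'I_N -> T -> R) :=
  forall c : 'I_N -> R, (forall s, \sum_i c i * b i s = 0) -> forall i, c i = 0.

End combinations.

Section gram.
Context d (T : measurableType d) (R : realType).
Variable mu : {measure set T -> \bar R}.
Local Notation L2 := (L2 mu).
Local Notation "<< f , g >>" := (L2_dot mu f g).

Lemma submod_L2 : submod L2.
Proof. by split; [exact: L2_0|move=> *; exact: L2_lin]. Qed.

Lemma L2_comb N (c : 'I_N -> R) (a : 'I_N -> T -> R) :
  (forall i, L2 (a i)) -> L2 (comb c a).
Proof. by apply: comb_submod; exact: submod_L2. Qed.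

Lemma L2_dot_comb N (c : 'I_N -> R) (a : 'I_N -> T -> R) f :
  (forall i, L2 (a i)) -> L2 f ->
  << comb c a, f >> = \sum_i c i * << a i, f >>.
Proof.
move=> La Lf; rewrite L2_dot_suml//; last by move=> i _; exact: L2Z.
by apply: eq_bigr => i _; rewrite L2_dotZl.
Qed.

(** A quadratic form attains its maximum on the unit sphere, which is compact, and
    the inequality extends to all vectors by homogeneity.  The maximizer is an
    eigenvector of the Gram matrix, as [gram_maximizer_orth] shows. *)
Lemma gram_maximizer N (a : 'I_N.+1 -> T -> R) : (forall i, L2 (a i)) ->
  exists2 c : 'I_N.+1 -> R, \sum_i c i ^+ 2 = 1 &
   forall e, << comb e a, comb e a >> <=
     << comb c a, comb c a >> * \sum_i e i ^+ 2.
Proof.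
move=> La.
pose q (v : 'rV[R]_N.+1) := \sum_i \sum_j v 0 i * v 0 j * << a i, a j >>.
have qE v : q v = << comb (v 0) a, comb (v 0) a >>.
  rewrite L2_dot_comb//; last exact: L2_comb.
  apply: eq_bigr => i _; rewrite L2_dotC L2_dot_comb// mulr_sumr.
  by apply: eq_bigr => j _; rewrite mulrA [<< a j, _ >>]L2_dotC.
pose n2 (v : 'rV[R]_N.+1) := \sum_i v 0 i ^+ 2.
have cv i : continuous (fun v : 'rV[R]_N.+1 => v 0 i).
  exact: coord_continuous.
have cq : continuous q.
  move=> v; apply: (@cvg_sumr _ _ _ (nbhs v)) => i; apply: (@cvg_sumr _ _ _ (nbhs v)) => j.
  exact: (cvgM (cvgM (cv i v) (cv j v)) (cvg_cst _)).
have cn2 : continuous n2.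
  by move=> v; apply: (@cvg_sumr _ _ _ (nbhs v)) => i; exact: (cvgM (cv i v) (cv i v)).
pose A := [set v : 'rV[R]_N.+1 | n2 v = 1].
have A0 : A !=set0.
  exists (\row_j (j == ord_max)%:R); rewrite /A/= /n2.
  rewrite (bigD1 ord_max)//= mxE eqxx expr1n big1 ?addr0// => j /negPf jm.
  by rewrite mxE jm expr0n.
have cA : compact A.
  apply: bounded_closed_compact.
    exists 1; split; first exact: num_real.
    move=> M M1 v Av; rewrite /Num.norm/= mx_normrE.
    apply/bigmax_leP; split; first exact: ltW (lt_trans ltr01 M1).
    move=> [i j] _ /=; rewrite (ord1 i) (le_trans _ (ltW M1))//.
    rewrite -(ler_pXn2r (n := 2))// ?nnegrE// expr1n -Av real_normK ?num_real//.
    by rewrite /n2 (bigD1 j)//= lerDl sumr_ge0// => *; exact: sqr_ge0.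
  rewrite (_ : A = n2 @^-1` [set 1])//.
  by apply: closed_comp => [v _|]; [exact: cn2|exact: closed_eq].
have [|c] := EVT_max_rV A0 cA (f := q); first exact: continuous_subspaceT.
rewrite inE => Ac qc; exists (c 0) => // e.
have [e0|e0] := pselect (exists i, e i != 0); last first.
  have {}e0 i : e i = 0 by apply/eqP/negPn/negP => ei; apply: e0; exists i.
  rewrite L2_dot_comb//; last exact: L2_comb.
  rewrite big1 => [|i _]; last by rewrite e0 mul0r.
  by rewrite big1 ?mulr0// => i _; rewrite e0 expr0n.
have [k k1 _] := unit_multiple e0.
have /qc : (\row_i (k * e i)) \in A.
  by rewrite inE /A/= /n2; under eq_bigr do rewrite mxE.
rewrite !qE.
have -> : comb ((\row_i (k * e i)) 0) a = k *: comb e a.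
  by rewrite /comb scaler_sumr; apply: eq_bigr => i _; rewrite mxE scalerA.
rewrite L2_dotZl ?L2_dotZr//; try (by apply: L2Z; exact: L2_comb); try exact: L2_comb.
move: k1; under eq_bigr do rewrite exprMn.
rewrite -mulr_sumr mulrA -expr2 => k1.
have k2 : 0 < k ^+ 2.
  rewrite exprn_even_gt0//=; apply: contra_eq_neq k1 => ->.
  by rewrite expr0n mul0r eq_sym oner_neq0.
move=> h; rewrite -(ler_pM2l k2); apply: le_trans h _.
by rewrite mulrCA k1 mulr1.
Qed.

(** First-order condition at the maximum: moving [c] by [t *: e] gives
    [2 * t * B <= t ^+ 2 * K] for all [t], where [B] is the product to be computed,
    and this forces [B = 0]. *)
Lemma gram_maximizer_orth N (a : 'I_N.+1 -> T -> R) (c : 'I_N.+1 -> R) :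
  (forall i, L2 (a i)) -> \sum_i c i ^+ 2 = 1 ->
  (forall e, << comb e a, comb e a >> <=
     << comb c a, comb c a >> * \sum_i e i ^+ 2) ->
  forall e, \sum_i e i * c i = 0 -> << comb e a, comb c a >> = 0.
Proof.
move=> La c1 cmax e ec.
set B := << _, _ >>; set m := << comb c a, comb c a >> in cmax.
pose K := m * (\sum_i e i ^+ 2) - << comb e a, comb e a >>.
have K0 : 0 <= K by rewrite subr_ge0.
have ineq (t : R) : 2 * t * B <= t ^+ 2 * K.
  have := cmax (fun i => t * e i + c i).
  rewrite -comb_lin L2_dot_sqrD//; try (by apply: L2Z; exact: L2_comb);
    try exact: L2_comb.
  have -> : \sum_i (t * e i + c i) ^+ 2 = t ^+ 2 * \sum_i e i ^+ 2 + 1.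
    rewrite (eq_bigr (fun i => t ^+ 2 * e i ^+ 2 + 2 * t * (e i * c i)
      + c i ^+ 2)); last by move=> i _; ring.
    by rewrite !big_split/= -!mulr_sumr ec c1; ring.
  rewrite L2_dotZl ?L2_dotZr ?L2_dotZl//; try (by apply: L2Z; exact: L2_comb);
    try exact: L2_comb.
  rewrite -/B -/m /K; lra.
apply/eqP/negPn/negP => B0.
have B2 : 0 < B ^+ 2 by rewrite exprn_even_gt0.
have K1 : 0 < K + 1 by rewrite ltr_wpDl.
(* K + 1 rather than K, which may be 0. *)
have := ineq (B / (K + 1)).
rewrite -(ler_pM2r (exprn_gt0 2 K1)).
rewrite (_ : _ * _ ^+ 2 = 2 * B ^+ 2 * (K + 1)); last by field; rewrite gt_eqF.
rewrite (_ : (B / (K + 1)) ^+ 2 * K * _ = B ^+ 2 * K); last by field; rewrite gt_eqF.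
nra.
Qed.

(** Split off the maximizer [beta] of [gram_maximizer] by a reflection and recurse.
    The class [S] is arbitrary because the recursive call uses the functions of [S]
    that are orthogonal to [beta]. *)
Lemma kernel_orthogonalize N : forall (S : set (T -> R)) (a : 'I_N -> T -> R),
  submod S -> S `<=` L2 -> (forall i, S (a i)) ->
  exists b : 'I_N -> T -> R, [/\ forall i, S (b i),
    forall s t, kernel_of a s t = kernel_of b s t &
    forall i j, i != j -> << b i, b j >> = 0].
Proof.
elim: N => [|N IH] S a Ss SL Sa; first by exists a; split => // -[].
have La i : L2 (a i) by exact: SL.
have [c0 c01 cmax0] := gram_maximizer La.
have [k k1 cm] : exists2 k : R, \sum_i (k * c0 i) ^+ 2 = 1 & k * c0 ord_max <= 0.
  apply: unit_multiple; apply: contrapT => h.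
  suff : \sum_i c0 i ^+ 2 = 0 by rewrite c01 => /eqP; rewrite oner_eq0.
  rewrite big1// => i _; apply/eqP; rewrite sqrf_eq0; apply/negPn/negP => ci.
  by apply: h; exists i.
have k2 : k ^+ 2 = 1.
  by rewrite -k1; under [RHS]eq_bigr do rewrite exprMn; rewrite -mulr_sumr c01 mulr1.
pose c i := k * c0 i.
have cmax e : << comb e a, comb e a >> <= << comb c a, comb c a >> * \sum_i e i ^+ 2.
  have -> : comb c a = k *: comb c0 a.
    by rewrite /comb scaler_sumr; apply: eq_bigr => i _; rewrite scalerA.
  rewrite L2_dotZl ?L2_dotZr//; try (by apply: L2Z; exact: L2_comb); try exact: L2_comb.
  by rewrite mulrA -expr2 k2 mul1r.
have orth := gram_maximizer_orth La k1 cmax.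
have [D [Dc Dk]] := householder Ss Sa k1 cm.
pose beta := comb c a; have Sbeta : S beta by exact: comb_submod.
pose S' := [set f | S f /\ << f, beta >> = 0].
have S's : submod S'.
  split; first by split; [case: Ss|rewrite L2_dot0l].
  move=> k' f g [Sf f0] [Sg g0]; split; first by case: Ss => _; apply.
  by rewrite L2_dot_linl ?f0 ?g0 ?mulr0 ?addr0//; exact: SL.
have S'D i : S' (comb (D i) a).
  by split; [exact: comb_submod|exact: orth].
have [|b [Sb bk bo]] := IH _ _ S's _ S'D; first by move=> f [/SL].
exists (append b beta); split.
- move=> i; have [->|[j ->]] := ord_recrP i; rewrite ?append_max ?append_widen//.
  by case: (Sb j).
- by move=> s t; rewrite Dk !kernel_of_append bk.
- move=> i j; have [->|[i' ->]] := ord_recrP i; have [->|[j' ->]] := ord_recrP j;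
    rewrite ?append_max ?append_widen ?eqxx//.
  + by move=> _; rewrite L2_dotC; case: (Sb j').
  + by move=> _; case: (Sb i').
  + move=> ij; apply: bo; apply: contra ij => /eqP ->//.
Qed.

(** Independence comes from taking as few functions as possible: a unit vector [c]
    with [comb c b = 0] would let a reflection represent the same kernel with one
    function less. *)
Theorem kernel_decomposition (S : set (T -> R)) N (a : 'I_N -> T -> R) :
  submod S -> S `<=` L2 -> (forall i, S (a i)) ->
  exists M (b : 'I_M -> T -> R), [/\ forall i, S (b i),
    forall s t, kernel_of a s t = kernel_of b s t,
    forall i j, i != j -> << b i, b j >> = 0 & lin_indep b].
Proof.
move=> Ss SL Sa.
pose P n := `[< exists b : 'I_n -> T -> R, (forall i, S (b i)) /\
   forall s t, kernel_of a s t = kernel_of b s t >].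
have [|M /asboolP[b0 [Sb0 b0k]] Mmin] := @ex_minnP P.
  by exists N; apply/asboolP; exists a.
have [b [Sb bk bo]] := kernel_orthogonalize Ss SL Sb0.
exists M, b; split => // [s t|]; first by rewrite b0k.
move=> c cb; apply: contrapT => /existsNP[i0 /eqP ci0].
move: M c i0 ci0 b0 Mmin b Sb bk bo cb Sb0 b0k => [|M]; first by move=> ? [].
move=> c i0 ci0 b0 Mmin b Sb bk bo cb Sb0 b0k.
have [|k k1 cm] := @unit_multiple R _ c; first by exists i0.
have [D [_ Dk]] := householder Ss Sb k1 cm.
suff /Mmin : P M by rewrite ltnn.
apply/asboolP; exists (fun i => comb (D i) b); split.
  by move=> i; exact: comb_submod.
move=> s t; rewrite b0k bk Dk kernel_of_append combE.
under [X in X * _]eq_bigr do rewrite -mulrA.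
by rewrite -mulr_sumr cb mulr0 mul0r addr0.
Qed.

End gram.

(** * Operators diagonal in an orthogonal family *)

Lemma cvg_increasing_subseq (R : realType) (v : nat -> R) (l : R) (e : nat -> nat) :
  {homo e : m n / (m < n)%N} -> v @ \oo --> l -> v (e n) @[n --> \oo] --> l.
Proof.
move=> he vl; apply: (@cvg_comp _ _ _ e v _ \oo) => //.
have en n : (n <= e n)%N by elim: n => // n IH; exact: leq_ltn_trans IH (he _ _ _).
apply/cvgnyPge => A; near=> n; apply: leq_trans (en n).
by near: n; exact: nbhs_infty_ge.
Unshelve. all: by end_near. Qed.

Lemma bolzano_weierstrass_family (R : realType) N (u : 'I_N -> nat -> R) :
  (forall i, exists C, forall n, `|u i n| <= C) ->
  exists e : nat -> nat, {homo e : m n / (m < n)%N} /\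
    exists l : 'I_N -> R, forall i, u i (e n) @[n --> \oo] --> l i.
Proof.
elim: N u => [|N IH] u bu.
  by exists id; split => //; exists (fun=> 0) => -[].
have [i|e [he [l ul]]] := IH (fun i => u (widen_ord (leqnSn N) i)).
  exact: bu.
have [C uC] := bu ord_max.
have [|f fmono fl] := @bolzano_weierstrass R (fun n => u ord_max (e n)).
  exists C; split; first exact: num_real.
  by move=> M CM n _ /=; exact: le_trans (uC _) (ltW CM).
have hf : {homo f : m n / (m < n)%N}.
  by move=> m n mn; have := leW_mono fmono m n; rewrite !ltEnat /= mn.
exists (e \o f); split; first by move=> m n /hf /he.
exists (fun i => lim (u i (e (f n)) @[n --> \oo])) => i.
have [->//|[j ->]] := ord_recrP i.
have h := cvg_increasing_subseq hf (ul j).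
by apply/cvg_ex; exists (l j).
Qed.

Section diagonal_operators.
Context d (T : measurableType d) (R : realType).
Variable mu : {measure set T -> \bar R}.
Local Notation L2 := (L2 mu).
Local Notation "<< f , g >>" := (L2_dot mu f g).
Local Notation "f =ae g" := (f = g %[ae mu]) (at level 70).
Variables (N : nat) (b : 'I_N -> T -> R).
Hypothesis Lb : forall i, L2 (b i).
Hypothesis ob : forall i j, i != j -> << b i, b j >> = 0.
Local Notation lam p := (<< b p, b p >>).

(** The family is orthogonal but not normalized, since some of its members may
    vanish almost everywhere.  The operator multiplies [b p] by [c p * lam p]. *)
Definition diag_op (c : 'I_N -> R) (f : T -> R) :=
  comb (fun p => c p * << f, b p >>) b.

Lemma L2_diag c f : L2 (diag_op c f).
Proof. exact: L2_comb. Qed.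
Hint Resolve L2_diag : core.

Lemma comb_coord c q : << comb c b, b q >> = c q * lam q.
Proof.
rewrite L2_dot_comb// (bigD1 q)//= big1 ?addr0// => p pq.
by rewrite ob// mulr0.
Qed.

Lemma diag_coord c f q : << diag_op c f, b q >> = c q * lam q * << f, b q >>.
Proof. by rewrite comb_coord mulrAC. Qed.

Lemma diag_lin c (k : R) f h : L2 f -> L2 h ->
  diag_op c (k *: f + h) = k *: diag_op c f + diag_op c h.
Proof.
move=> Lf Lh; rewrite comb_lin; apply: eq_bigr => p _.
by rewrite L2_dot_linl//; congr (_ *: _); ring.
Qed.

Lemma diag_dot c f h : L2 h ->
  << diag_op c f, h >> = \sum_p c p * (<< f, b p >> * << h, b p >>).
Proof.
move=> Lh; rewrite L2_dot_comb//; apply: eq_bigr => p _.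
by rewrite -mulrA [<< b p, h >>]L2_dotC.
Qed.

Lemma coord_lam0 f p : L2 f -> lam p = 0 -> << f, b p >> = 0.
Proof. by move=> Lf lp; exact: L2_dot_null. Qed.

(** The coordinate of [f] along a null [b p] is 0, so that [c p] is then irrelevant.
    This is what allows coefficients such as [(lam p)^-1]. *)
Lemma eq_diag c e f : L2 f -> (forall p, lam p != 0 -> c p = e p) ->
  diag_op c f = diag_op e f.
Proof.
move=> Lf ce; apply: eq_bigr => p _; congr (_ *: _).
by have [l0|/ce ->//] := eqVneq (lam p) 0; rewrite coord_lam0// !mulr0.
Qed.

Lemma diag_diag c e f : L2 f ->
  diag_op c (diag_op e f) = diag_op (fun p => c p * lam p * e p) f.
Proof.
move=> Lf; apply: eq_bigr => p _; congr (_ *: _).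
by rewrite diag_coord; ring.
Qed.

Lemma ae_coord f h p : L2 f -> L2 h -> f =ae h -> << f, b p >> = << h, b p >>.
Proof. by move=> Lf Lh fh; apply: ae_eq_L2_dot => //; exact: ae_refl. Qed.

Lemma eq_coord_diag c f h : (forall p, << f, b p >> = << h, b p >>) ->
  diag_op c f = diag_op c h.
Proof. by move=> fh; apply: eq_bigr => p _; rewrite fh. Qed.

Section operator.
Variables (c : 'I_N -> R) (M : (T -> R) -> T -> R).
Hypothesis ME : forall f, L2 f -> M f = diag_op c f.

Lemma diag_bounded : bounded_operator mu M.
Proof.
split; first by move=> f Lf; rewrite ME.
  move=> k f h Lf Lh; rewrite !ME//; last exact: L2_lin.
  by rewrite diag_lin//; exact: ae_refl.
exists (Num.sqrt (\sum_p (c p * lam p) ^+ 2)) => f Lf.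
rewrite !L2_normE ?ME// -sqrtrM ?sumr_ge0// => [|p _]; last exact: sqr_ge0.
apply: ler_wsqrtr; rewrite diag_dot// mulr_suml; apply: ler_sum => p _.
rewrite diag_coord (_ : _ * _ = c p ^+ 2 * lam p * << f, b p >> ^+ 2); last by ring.
rewrite (_ : _ * << f, f >> = c p ^+ 2 * lam p * (<< f, f >> * lam p)); last by ring.
apply: ler_wpM2l; last exact: L2_CauchySchwarz.
by apply: mulr_ge0; [exact: sqr_ge0|exact: L2_dot_ge0].
Qed.

Lemma diag_self_adjoint : self_adjoint mu M.
Proof.
move=> f h Lf Lh; rewrite !ME// [RHS]L2_dotC !diag_dot//.
by apply: eq_bigr => p _; rewrite [X in _ * X]mulrC.
Qed.

Lemma diag_positive : (forall p, 0 <= c p) -> positive_operator mu M.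
Proof.
move=> c0 f Lf; rewrite ME// diag_dot// sumr_ge0// => p _.
by rewrite mulr_ge0// -expr2 sqr_ge0.
Qed.

(** The operator depends on finitely many coordinates, which converge along a common
    subsequence. *)
Lemma diag_compact : compact_operator mu M.
Proof.
move=> F LF [C FC].
have [p|e [he [l xl]]] := @bolzano_weierstrass_family R N (fun p n => << F n, b p >>).
  exists (C * L2_norm mu (b p)) => n.
  rewrite -(ler_pXn2r (n := 2)) ?nnegrE//; last first.
    by rewrite mulr_ge0 ?L2_norm_ge0// (le_trans _ (FC 0))// L2_norm_ge0.
  rewrite real_normK ?num_real// (le_trans (L2_CauchySchwarz _ _))//.
  rewrite exprMn L2_norm_sqr// ler_wpM2r ?L2_dot_ge0//.
  by rewrite -L2_norm_sqr// lerXn2r ?nnegrE ?L2_norm_ge0// (le_trans _ (FC n))// L2_norm_ge0.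
exists e; split => //.
pose h := comb (fun p => c p * l p) b; have Lh : L2 h by exact: L2_comb.
exists h => //; rewrite /L2_cvg.
have nE n : L2_norm mu (M (F (e n)) - h) =
    Num.sqrt (\sum_p c p ^+ 2 * lam p * (<< F (e n), b p >> - l p) ^+ 2).
  rewrite L2_normE ?ME//; last exact: L2B.
  congr Num.sqrt.
  have -> : diag_op c (F (e n)) - h = comb (fun p => c p * (<< F (e n), b p >> - l p)) b.
    rewrite addrC -scaleN1r comb_lin; apply: eq_bigr => p _; congr (_ *: _); ring.
  rewrite L2_dot_comb//; last exact: L2_comb.
  by apply: eq_bigr => p _; rewrite [<< b p, comb _ _ >>]L2_dotC comb_coord; ring.
under eq_cvg do rewrite nE.
have l0 : \sum_p c p ^+ 2 * lam p * (l p - l p) ^+ 2 = 0.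
  by rewrite big1// => p _; rewrite subrr expr0n mulr0.
have xl0 p : << F (e n), b p >> - l p @[n --> \oo] --> l p - l p.
  by apply: cvgB; [exact: xl|exact: cvg_cst].
have : \sum_p c p ^+ 2 * lam p * (<< F (e n), b p >> - l p) ^+ 2 @[n --> \oo]
    --> \sum_p c p ^+ 2 * lam p * (l p - l p) ^+ 2.
  apply: (@cvg_sumr _ _ _ \oo) => p.
  by apply: cvgM; [exact: cvg_cst|exact: cvgM (xl0 p) (xl0 p)].
move/(continuous_cvg _ (@sqrt_continuous R _)).
by rewrite l0 sqrtr0.
Qed.

End operator.

Lemma null_space_diag c M : (forall f, L2 f -> M f = diag_op c f) ->
  (forall p, lam p != 0 -> c p != 0) ->
  null_space mu M = [set f | L2 f /\ forall p, << f, b p >> = 0].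
Proof.
move=> ME c0; apply/seteqP; split=> f [Lf f0]; split => //.
  move=> p; have [l0|l0] := eqVneq (lam p) 0; first exact: coord_lam0.
  have := diag_coord c f p; rewrite -ME// => /eqP.
  rewrite (@ae_coord _ 0)//; [|by rewrite ME//|exact: L2_0].
  rewrite L2_dot0l eq_sym mulf_eq0 mulf_eq0 (negPf l0) (negPf (c0 _ l0))/=.
  by move/eqP.
rewrite ME// /diag_op /comb big1; first exact: ae_refl.
by move=> p _; rewrite f0 mulr0 scale0r.
Qed.

(** [proj] is the orthogonal projection onto [H]: composing it with itself multiplies
    [(lam p)^-1] by [lam p * (lam p)^-1], which is 1 unless [b p] is null. *)
Section spectral.
Variable L : (T -> R) -> T -> R.
Hypothesis LE : forall f, L2 f -> L f = diag_op (fun=> 1) f.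
Local Notation H := (L2_orth mu (null_space mu L)).
Local Notation proj := (diag_op (fun p => (lam p)^-1)).

Lemma null_spaceE : null_space mu L = [set f | L2 f /\ forall p, << f, b p >> = 0].
Proof. by apply: null_space_diag LE _ => p _; exact: oner_neq0. Qed.

Lemma range_sub_H c f : L2 f -> H (diag_op c f).
Proof.
move=> Lf; split => // a; rewrite null_spaceE => -[La a0].
by rewrite diag_dot// big1// => p _; rewrite a0 !mulr0.
Qed.

Lemma proj_coord f p : L2 f -> << proj f, b p >> = << f, b p >>.
Proof.
move=> Lf; rewrite diag_coord.
have [l0|l0] := eqVneq (lam p) 0; first by rewrite (coord_lam0 Lf l0) mulr0.
by rewrite mulVf// mul1r.
Qed.

(** The difference of the two sides is the squared norm of [f - proj f]. *)
Lemma bessel f : L2 f -> \sum_p (lam p)^-1 * << f, b p >> ^+ 2 <= << f, f >>.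
Proof.
move=> Lf; have LP := L2_diag (fun p => (lam p)^-1) f.
have PP : << proj f, proj f >> = \sum_p (lam p)^-1 * << f, b p >> ^+ 2.
  by rewrite diag_dot//; apply: eq_bigr => p _; rewrite proj_coord// expr2.
have fP : << f, proj f >> = \sum_p (lam p)^-1 * << f, b p >> ^+ 2.
  by rewrite L2_dotC diag_dot//; apply: eq_bigr => p _; rewrite expr2.
have := L2_dot_ge0 mu (f - proj f); rewrite L2_dot_sqrB// PP fP; lra.
Qed.

Lemma proj_null f : L2 f -> null_space mu L (f - proj f).
Proof.
move=> Lf; rewrite null_spaceE; split; first exact: L2B.
by move=> p; rewrite L2_dotBl// proj_coord// subrr.
Qed.

Lemma null_H_eq0 f : null_space mu L f -> H f -> f =ae 0.
Proof. by move=> nf [Lf /(_ _ nf) ff]; apply/(L2_dot_eq0 Lf). Qed.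

Lemma H_lin (k : R) f h : H f -> H h -> H (k *: f + h).
Proof.
move=> [Lf f0] [Lh h0]; split; first exact: L2_lin.
by move=> a na; rewrite L2_dot_linl ?f0 ?h0 ?mulr0 ?addr0//; case: na.
Qed.

Lemma H_sub f h : H f -> H h -> H (f - h).
Proof. by move=> Hf Hh; rewrite -scaleN1r addrC; exact: H_lin. Qed.

Lemma H_proj f : H f -> f =ae proj f.
Proof.
move=> Hf; have Lf := Hf.1; apply/(L2_ae_eqP Lf (L2_diag _ f)); apply/L2_dot_eq0; first exact: L2B.
apply: null_H_eq0; first exact: proj_null.
by apply: H_sub => //; exact: range_sub_H.
Qed.

(** On [H] a class is determined by its coordinates, because it is fixed by [proj]. *)
Lemma H_coord_inj f h : H f -> H h -> (forall p, << f, b p >> = << h, b p >>) ->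
  f =ae h.
Proof.
move=> Hf Hh fh; apply: ae_trans (H_proj Hf) _.
by rewrite (eq_coord_diag _ fh); apply: ae_sym; exact: H_proj.
Qed.

(** An operator with nonzero coefficients is injective on [H]: the coordinates of
    [M h] determine those of [h]. *)
Lemma diag_restr_inverse c M f h : (forall f, L2 f -> M f = diag_op c f) ->
  (forall p, lam p != 0 -> c p != 0) -> H h -> M h =ae f ->
  restr_inverse mu M H f h.
Proof.
move=> ME c0 Hh Mh; split => // h' Hh' Mh'.
have Lh := Hh.1; have Lh' := Hh'.1.
apply: H_coord_inj => // p.
have [l0|l0] := eqVneq (lam p) 0; first by rewrite (coord_lam0 Lh l0) (coord_lam0 Lh' l0).
have Mhh' : M h' =ae M h by apply: ae_trans Mh' _; exact: ae_sym.
have : << M h', b p >> = << M h, b p >> by apply: ae_coord => //; rewrite ME.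
rewrite !ME// !diag_coord => /mulfI; apply.
by rewrite mulf_neq0// c0.
Qed.

Lemma L2_orth_closed A : A `<=` L2 -> L2_closure mu (L2_orth mu A) = L2_orth mu A.
Proof.
move=> AL; apply/seteqP; split => [f [Lf fcl]|f [Lf f0]]; last first.
  split => // e e0; exists f => //; rewrite subrr L2_normE ?L2_dot0l ?sqrtr0//.
  exact: L2_0.
split => // a Aa; have La := AL _ Aa.
apply/eqP/negPn/negP => fa.
have fa2 : 0 < `|(<< f, a >>)| by rewrite normr_gt0.
have na0 : 0 < L2_norm mu a + 1 by rewrite ltr_wpDl// L2_norm_ge0.
have [h [Lh h0] fh] := fcl (`|(<< f, a >>)| / (L2_norm mu a + 1)) (divr_gt0 fa2 na0).
suff : `|(<< f, a >>)| <= L2_norm mu (f - h) * L2_norm mu a.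
  rewrite leNgt => /negP; apply.
  have : L2_norm mu (f - h) * L2_norm mu a <= L2_norm mu (f - h) * (L2_norm mu a + 1).
    by rewrite ler_wpM2l ?L2_norm_ge0// lerDl.
  move=> /le_lt_trans; apply.
  by rewrite -ltr_pdivlMr.
have -> : << f, a >> = << f - h, a >> by rewrite L2_dotBl// h0// subr0.
rewrite -(ler_pXn2r (n := 2)) ?nnegrE ?mulr_ge0 ?L2_norm_ge0//.
rewrite real_normK ?num_real// exprMn !L2_norm_sqr//; last exact: L2B.
by apply: L2_CauchySchwarz => //; exact: L2B.
Qed.

Lemma L_positive : positive_operator mu L.
Proof. by apply: (diag_positive LE) => p; exact: ler01. Qed.

Lemma L_self_adjoint : self_adjoint mu L.
Proof. exact: diag_self_adjoint LE. Qed.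

Lemma eigenvalue_ge0 (l : R) psi : L2 psi -> ~ psi =ae 0 ->
  L psi =ae l *: psi -> 0 <= l.
Proof.
move=> Lp p0 Lpsi.
have p1 : 0 < << psi, psi >>.
  by rewrite lt_def L2_dot_ge0 andbT; apply/eqP => /L2_dot_eq0 -/(_ Lp).
rewrite -(pmulr_lge0 _ p1) -L2_dotZl//.
rewrite -(@ae_eq_L2_dot _ _ _ _ (L psi) _ psi) ?LE//; [|exact: L2Z| |exact: ae_refl].
  by rewrite -LE//; exact: L_positive.
by rewrite -LE.
Qed.

Lemma lin_span_filter (A : set (T -> R)) n (c : 'I_n -> R) (a : 'I_n -> T -> R) :
  (forall i, A (a i) \/ c i = 0) -> lin_span A (\sum_i c i *: a i).
Proof.
elim: n c a => [|n IH] c a Aa; first by exists 0%N, c, a; split => // -[].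
rewrite big_ord_recr/=.
have [m [c' [a' [Aa' ->]]]] := IH (fun i => c (widen_ord (leqnSn n) i))
  (fun i => a (widen_ord (leqnSn n) i)) (fun i => Aa _).
have [Am|->] := Aa ord_max; last by rewrite scale0r addr0; exists m, c', a'.
exists m.+1, (fun i => if unlift ord_max i is Some j then c' j else c ord_max),
  (append a' (a ord_max)).
split=> [i|].
  by have [->|[j ->]] := ord_recrP i; rewrite ?append_max ?append_widen.
rewrite [RHS]big_ord_recr/= append_max unlift_none; congr +%R.
apply: eq_bigr => i _; rewrite append_widen; congr (_ *: _).
rewrite (_ : widen_ord _ i = lift ord_max i) ?liftK//.
by apply/val_inj; exact: esym (lift_max i).
Qed.

(** For [f] in [H] the coefficients of its expansion along the eigenfunctions of
    eigenvalue 0 vanish, so the partial sums lie in the span of the others.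
    Conversely an eigenfunction of positive eigenvalue is orthogonal to the null
    space by self-adjointness, and [H] is closed. *)
Lemma eigenbasis_closure (l : nat -> R) psi : eigenbasis mu L l psi ->
  L2_closure mu (lin_span [set psi i | i in [set i | 0 < l i]]) = H.
Proof.
move=> [Lpsi Epsi opsi cpsi].
have psi0 i : ~ psi i =ae 0.
  by move/(L2_dot_eq0 (Lpsi i)); rewrite opsi eqxx => /eqP; rewrite oner_eq0.
have l0 i : 0 <= l i by exact: eigenvalue_ge0 (Lpsi i) (psi0 i) (Epsi i).
have lpsi i a : L2 a -> << L (psi i), a >> = l i * << psi i, a >>.
  move=> La; rewrite -L2_dotZl//; apply: ae_eq_L2_dot => //.
  - by rewrite LE.
  - exact: L2Z.
  - exact: ae_refl.
apply/seteqP; split => f.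
  rewrite -(@L2_orth_closed (null_space mu L)); last by move=> a [].
  move=> [Lf fcl]; split => // e /fcl[h [n [c [a [Ha ->]]]] fh].
  exists (\sum_(i < n) c i *: a i) => //.
  have Hai i : H (a i).
    have [j j0 <-] := Ha i; split => // h' nh'; have [Lh' h'0] := nh'.
    apply/eqP; rewrite -(mulrI_eq0 _ (mulfI (lt0r_neq0 j0))) -lpsi//.
    rewrite L_self_adjoint// (@ae_eq_L2_dot _ _ _ _ _ (psi j) _ 0) ?LE//.
    + by rewrite L2_dotC L2_dot0l.
    + exact: L2_0.
    + exact: ae_refl.
    + by rewrite -LE.
  apply: (big_ind (fun g => H g)).
  - by split; [exact: L2_0|move=> ? _; rewrite L2_dot0l].
  - by move=> f1 f2 H1 H2; rewrite -[f1]scale1r; exact: H_lin.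
  - move=> i _; rewrite -[_ *: _]addr0; apply: H_lin => //.
    by split; [exact: L2_0|move=> ? _; rewrite L2_dot0l].
move=> Hf; have [Lf f0] := Hf; split => // e e0.
have /cvgr0_norm_lt /(_ _ e0) [n _ /(_ n (leqnn n))] := cpsi f Lf.
rewrite ger0_norm ?L2_norm_ge0// => fn.
exists (\sum_(i < n) << f, psi i >> *: psi i).
  apply: lin_span_filter => i.
  have [li|li] := ltP 0 (l i); first by left; exists (i : nat).
  right; apply: f0; split => //.
  apply: ae_trans (Epsi i) _.
  have -> : l i = 0 by apply/eqP; rewrite eq_le li l0.
  by rewrite scale0r; exact: ae_refl.
rewrite -[X in L2_norm _ X]opprB -scaleN1r L2_normZ; last first.
  by apply: L2B => //; apply: L2_sum => i _; exact: L2Z.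
by rewrite normrN1 mul1r.
Qed.

Local Notation Lsqrt := (diag_op (fun p => (Num.sqrt (lam p))^-1)).

Lemma sqrt_diag : sqrt_operator mu L Lsqrt.
Proof.
split.
- exact: diag_bounded.
- exact: diag_self_adjoint.
- by apply: diag_positive => // p; rewrite invr_ge0 sqrtr_ge0.
- move=> f Lf; rewrite LE// diag_diag//; rewrite (@eq_diag _ (fun=> 1))//.
    exact: ae_refl.
  move=> p l0; rewrite mulrAC -invfM -expr2 sqr_sqrtr ?L2_dot_ge0//.
  by rewrite mulVf.
Qed.

Lemma diag_eigenvector q : L (b q) = lam q *: b q.
Proof.
rewrite LE// /diag_op /comb (bigD1 q)//= big1 ?addr0 ?mul1r// => p pq.
by rewrite mul1r ob 1?eq_sym// scale0r.
Qed.

Lemma sqrt_lam_neq0 p : lam p != 0 -> Num.sqrt (lam p) != 0.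
Proof. by move=> l0; rewrite sqrtr_eq0 -ltNge lt_def l0 L2_dot_ge0. Qed.

Lemma inv_lam_sqrt p : lam p != 0 ->
  (lam p)^-1 * Num.sqrt (lam p) = (Num.sqrt (lam p))^-1.
Proof.
move=> l0; have := sqrt_lam_neq0 l0.
have : lam p = Num.sqrt (lam p) ^+ 2 by rewrite sqr_sqrtr// L2_dot_ge0.
by set r := Num.sqrt _ => -> r0; field.
Qed.

Lemma sqrt_diag_inv f : L2 f ->
  Lsqrt (diag_op (fun p => (lam p)^-1 / Num.sqrt (lam p)) f) = proj f.
Proof.
move=> Lf; rewrite diag_diag//; apply: eq_diag => // p l0.
have := sqrt_lam_neq0 l0.
have : lam p = Num.sqrt (lam p) ^+ 2 by rewrite sqr_sqrtr// L2_dot_ge0.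
by set r := Num.sqrt _ => -> r0; field.
Qed.

(** A nonnegative root [M] of [L] vanishes on the null space of [L], as
    [<< M f, M f >> = << L f, f >>].  On [b q], with [r] the square root of [lam q],
    the function [h = M (b q) - r *: b q] satisfies [M h = - r *: h], which
    positivity allows only if [h] is null or [r = 0].  Both facts determine [M] on
    [proj f] and on [f - proj f]. *)
Lemma sqrt_unique M : sqrt_operator mu L M ->
  forall f, L2 f -> M f =ae Lsqrt f.
Proof.
move=> [Mb Ms Mp M2] f Lf; have [ML Mlin _] := Mb.
have Mf0 h : L2 h -> (forall p, << h, b p >> = 0) -> M h =ae 0.
  move=> Lh h0; apply/L2_dot_eq0; first exact: ML.
  rewrite -Ms//; last exact: ML.
  rewrite (@ae_eq_L2_dot _ _ _ _ _ (L h) _ h)//; last 4 first.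
  - by do 2!apply: (ML).
  - by rewrite LE.
  - exact: M2.
  - exact: ae_refl.
  by rewrite LE// diag_dot// big1// => p _; rewrite h0 mul0r mulr0.
have M0 : M 0 =ae 0.
  by apply: Mf0; [exact: L2_0|move=> p; rewrite L2_dot0l].
have Mb_eig q : M (b q) =ae Num.sqrt (lam q) *: b q.
  set r := Num.sqrt (lam q).
  have LMb : L2 (M (b q)) by exact: ML.
  have r2 : r ^+ 2 = lam q by rewrite sqr_sqrtr// L2_dot_ge0.
  pose h := (- r) *: b q + M (b q); have Lh : L2 h by exact: L2_lin.
  have Mh : M h =ae (- r) *: h.
    apply: ae_trans (Mlin _ _ _ (Lb q) LMb) _.
    have := ae_lin (- r) (ae_refl mu (M (b q))) (M2 _ (Lb q)).
    rewrite diag_eigenvector -r2 => /ae_trans; apply.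
    rewrite /h scalerDr scalerA mulrNN -expr2 addrC.
    exact: ae_refl.
  have hh : << h, h >> = 0 \/ r = 0.
    have := Mp _ Lh.
    rewrite (@ae_eq_L2_dot _ _ _ _ _ ((- r) *: h) _ h) ?L2_dotZl//; last 3 first.
    - exact: ML.
    - exact: L2Z.
    - exact: ae_refl.
    have [r0|r0] := eqVneq r 0; first by right.
    rewrite mulNr oppr_ge0 pmulr_rle0 ?lt_def ?r0 ?sqrtr_ge0// => hh0.
    by left; apply/eqP; rewrite eq_le hh0 L2_dot_ge0.
  case: hh => [/(L2_dot_eq0 Lh) h0|r0].
    apply: filterS h0 => s /(_ I); rewrite /h !fctE => h0 _.
    by move/eqP: h0; rewrite scaleNr addrC subr_eq0 => /eqP.
  rewrite r0 scale0r; apply: Mf0 => // p.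
  have lq : lam q = 0 by rewrite -r2 r0 expr0n.
  by rewrite L2_dotC; exact: coord_lam0.
have Mcomb c : M (comb c b) =ae comb (fun p => c p * Num.sqrt (lam p)) b.
  rewrite /comb; elim: (index_enum _) => [|p s IH]; first by rewrite !big_nil.
  rewrite !big_cons.
  have Ls : L2 (\sum_(j <- s) c j *: b j) by apply: L2_sum => j _; exact: L2Z.
  apply: ae_trans (Mlin _ _ _ (Lb p) Ls) _.
  by rewrite -scalerA; exact: ae_lin.
have : M f =ae M (1 *: proj f + (f - proj f)).
  by rewrite scale1r addrC subrK; exact: ae_refl.
move=> /ae_trans; apply.
have Lfp : L2 (f - proj f) by exact: L2B.
apply: ae_trans (Mlin _ _ _ (L2_diag _ f) Lfp) _.
have z : M (f - proj f) =ae 0.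
  by apply: Mf0 => // p; rewrite L2_dotBl// proj_coord// subrr.
apply: ae_trans (ae_lin 1 (Mcomb _) z) _.
rewrite scale1r addr0 (_ : comb _ b = Lsqrt f); first exact: ae_refl.
apply: eq_bigr => p _; congr (_ *: _).
have [l0|l0] := eqVneq (lam p) 0; first by rewrite (coord_lam0 Lf l0) !mulr0 mul0r.
by rewrite [LHS]mulrAC (inv_lam_sqrt l0).
Qed.

Lemma H_range_sqrt : H = L2_range mu Lsqrt.
Proof.
apply/seteqP; split => f.
  move=> Hf; have Lf := Hf.1; split => //.
  exists (diag_op (fun p => (lam p)^-1 / Num.sqrt (lam p)) f) => //.
  apply: ae_trans (H_proj Hf) _; rewrite sqrt_diag_inv//.
  exact: ae_refl.
move=> [Lf [h Lh fh]]; split => // a na.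
have [_ /(_ a na) <-] := range_sub_H (fun p => (Num.sqrt (lam p))^-1) Lh.
by have [La _] := na; apply: ae_eq_L2_dot => //; exact: ae_refl.
Qed.

Lemma sqrt_restr_inverse f : L2_range mu Lsqrt f ->
  restr_inverse mu Lsqrt H f (diag_op (fun p => (lam p)^-1 / Num.sqrt (lam p)) f).
Proof.
rewrite -H_range_sqrt => Hf; have Lf := Hf.1.
apply: (@diag_restr_inverse (fun p => (Num.sqrt (lam p))^-1)) => //.
- by move=> p l0; rewrite invr_eq0 sqrt_lam_neq0.
- exact: range_sub_H.
- by rewrite sqrt_diag_inv//; apply: ae_sym; exact: H_proj.
Qed.

(** Completing the square, [E phi] is the sum of the squares of the coordinates of
    [phi - phistar] plus a constant. *)
Lemma quadratic_minimizer (E : (T -> R) -> R) (k : R) phistar phiD :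
  L2 phistar -> L2 phiD -> phiD =ae L phistar ->
  (forall phi, L2 phi -> E phi = << L phi, phi >> - 2 * << phiD, phi >> + k) ->
  [/\ H (proj phistar),
      (forall psi, H psi -> E (proj phistar) <= E psi),
      (forall phi, H phi -> (forall psi, H psi -> E phi <= E psi) ->
         phi =ae proj phistar),
      restr_inverse mu L H phiD (proj phistar) &
      orth_proj_of mu H phistar (proj phistar)].
Proof.
move=> Ls LD phiDE EE.
have E2 phi : L2 phi -> E phi =
    \sum_p (<< phi, b p >> - << phistar, b p >>) ^+ 2 + (k - << L phistar, phistar >>).
  move=> Lphi; rewrite EE// (@ae_eq_L2_dot _ _ _ _ phiD (L phistar) phi phi)//;
    [|by rewrite LE|exact: ae_refl].
  rewrite !LE// !diag_dot//.
  rewrite [X in _ = X + _](eq_bigr (fun p => 1 * (<< phi, b p >> * << phi, b p >>)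
    - 2 * (1 * (<< phistar, b p >> * << phi, b p >>))
    + 1 * (<< phistar, b p >> * << phistar, b p >>))); last by move=> p _; ring.
  by rewrite big_split/= sumrB -[X in _ = _ - X + _ + _]mulr_sumr; ring.
have Hp : H (proj phistar) by exact: range_sub_H.
have Ep : E (proj phistar) = k - << L phistar, phistar >>.
  rewrite E2// big1 ?add0r// => p _.
  by rewrite proj_coord// subrr expr0n.
split => //.
- move=> psi [Lpsi _]; rewrite Ep E2// lerDr sumr_ge0// => p _; exact: sqr_ge0.
- move=> phi Hphi /(_ _ Hp); have Lphi := Hphi.1.
  rewrite Ep E2// gerDr => s0; apply: H_coord_inj => // p.
  rewrite proj_coord//; apply/eqP; rewrite -subr_eq0 -sqrf_eq0.
  rewrite eq_le sqr_ge0 andbT; apply: le_trans s0.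
  by rewrite (bigD1 p)//= lerDl sumr_ge0// => q _; exact: sqr_ge0.
- apply: (diag_restr_inverse LE) => //.
  apply: ae_sym; apply: ae_trans phiDE _; rewrite !LE//.
  rewrite (@eq_coord_diag _ phistar (proj phistar)); first exact: ae_refl.
  by move=> p; rewrite proj_coord.
- split => // h [Lh h0]; rewrite L2_dotC; apply: h0; exact: proj_null.
Qed.

End spectral.
End diagonal_operators.

(** * Completing an orthonormal family *)

Section gram_schmidt.
Context d (T : measurableType d) (R : realType).
Variable mu : {measure set T -> \bar R}.
Local Notation L2 := (L2 mu).
Local Notation norm := (L2_norm mu).
Local Notation "<< f , g >>" := (L2_dot mu f g).
Local Notation "f =ae g" := (f = g %[ae mu]) (at level 70).
Implicit Types (f g : T -> R) (s : seq (T -> R)).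

Definition entry s (i : 'I_(size s)) : T -> R := nth 0 s i.

Definition orthonormal_seq s :=
  (forall i, (i < size s)%N -> L2 (nth 0 s i)) /\
  forall i j, (i < size s)%N -> (j < size s)%N ->
    << nth 0 s i, nth 0 s j >> = (i == j)%:R.

(** For an orthonormal [s] the operator subtracted is the orthogonal projection on
    the span of [s]. *)
Definition residual s f := f - diag_op mu (@entry s) (fun=> 1) f.

Section fixed.
Variable s : seq (T -> R).
Hypothesis on : orthonormal_seq s.

Let Ls (i : 'I_(size s)) : L2 (@entry s i).
Proof. by have [L _] := on; exact: L. Qed.

Let os (i j : 'I_(size s)) : i != j -> << @entry s i, @entry s j >> = 0.
Proof. by have [_ o] := on => ij; rewrite o// -[_ == _]/(i == j) (negPf ij). Qed.

Let ns (i : 'I_(size s)) : << @entry s i, @entry s i >> = 1.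
Proof. by have [_ o] := on; rewrite o// eqxx. Qed.

Lemma L2_residual f : L2 f -> L2 (residual s f).
Proof. by move=> Lf; apply: L2B => //; exact: L2_diag. Qed.

Lemma residual_lin (k : R) f g : L2 f -> L2 g ->
  residual s (k *: f + g) = k *: residual s f + residual s g.
Proof.
by move=> Lf Lg; rewrite /residual diag_lin// scalerBr opprD addrACA.
Qed.

Lemma residual_orth f (i : 'I_(size s)) : L2 f -> << residual s f, @entry s i >> = 0.
Proof.
move=> Lf; rewrite L2_dotBl//; last exact: L2_diag.
by rewrite diag_coord// ns !mul1r subrr.
Qed.

Lemma residual_sqr f : L2 f ->
  << residual s f, residual s f >> = << f, f >> - \sum_i << f, @entry s i >> ^+ 2.
Proof.
move=> Lf; have LP := L2_diag Ls (fun=> 1) f.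
have LR := L2_residual Lf.
rewrite {1}/residual L2_dotBl// [X in _ - X]L2_dotC.
have -> : << residual s f, diag_op mu (@entry s) (fun=> 1) f >> = 0.
  rewrite L2_dotC L2_dot_comb// big1// => i _.
  by rewrite [<< entry i, _ >>]L2_dotC residual_orth// mulr0.
rewrite subr0 L2_dotBr// [X in _ - X]L2_dotC diag_dot//; congr (_ - _).
by apply: eq_bigr => i _; rewrite mul1r expr2.
Qed.

Lemma residual_norm f : L2 f -> norm (residual s f) <= norm f.
Proof.
move=> Lf; rewrite !L2_normE//; last exact: L2_residual.
rewrite ler_wsqrtr// residual_sqr// gerBl sumr_ge0// => i _; exact: sqr_ge0.
Qed.

(** The residual is linear, does not increase norms, and kills [g]. *)
Lemma residual_best f g : L2 f -> L2 g -> norm (residual s g) = 0 ->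
  norm (residual s f) <= norm (f - g).
Proof.
move=> Lf Lg g0; have Lfg : L2 (f - g) by exact: L2B.
have := residual_lin 1 Lfg Lg; rewrite !scale1r subrK => ->.
rewrite (le_trans (L2_minkowski _ _))//; try exact: L2_residual.
by rewrite g0 addr0; exact: residual_norm.
Qed.

Lemma residual_comb n (c : 'I_n -> R) (a : 'I_n -> T -> R) :
  (forall i, L2 (a i)) -> (forall i, norm (residual s (a i)) = 0) ->
  norm (residual s (comb c a)) = 0.
Proof.
move=> La a0.
suff [] : L2 (comb c a) /\ norm (residual s (comb c a)) = 0 by [].
apply: (big_ind (fun f => L2 f /\ norm (residual s f) = 0)).
- split; first exact: L2_0.
  apply/eqP; rewrite eq_le L2_norm_ge0 andbT (le_trans (residual_norm (L2_0 mu)))//.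
  by rewrite L2_normE ?L2_dot0l ?sqrtr0//; exact: L2_0.
- move=> f g [Lf f0] [Lg g0]; split; first exact: L2D.
  apply/eqP; rewrite eq_le L2_norm_ge0 andbT.
  have := residual_lin 1 Lf Lg; rewrite !scale1r => ->.
  rewrite (le_trans (L2_minkowski _ _)) ?f0 ?g0 ?addr0//; exact: L2_residual.
- move=> i _; split; first exact: L2Z.
  have -> : c i *: a i = c i *: a i + 0 by rewrite addr0.
  rewrite residual_lin//; last exact: L2_0.
  have -> : residual s 0 = 0.
    have := residual_lin (-1) (L2_0 mu) (L2_0 mu).
    by rewrite scaler0 addr0 scaleN1r addNr.
  by rewrite addr0 L2_normZ ?a0 ?mulr0//; exact: L2_residual.
Qed.

End fixed.

Lemma residual_rcons s e f : residual (rcons s e) f = residual s f - << f, e >> *: e.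
Proof.
rewrite /residual /diag_op /comb -addrA -opprD; congr (_ - _).
rewrite -(big_mkord xpredT (fun i => (1 * << f, nth 0 (rcons s e) i >>) *: nth 0 (rcons s e) i)).
rewrite size_rcons big_nat_recr//= nth_rcons ltnn eqxx mul1r; congr (_ + _).
rewrite -[RHS](big_mkord xpredT (fun i => (1 * << f, nth 0 s i >>) *: nth 0 s i)).
by apply: eq_big_nat => i /andP[_ il]; rewrite nth_rcons il.
Qed.

Lemma orthonormal_rcons s e : orthonormal_seq s -> L2 e -> << e, e >> = 1 ->
  (forall i, (i < size s)%N -> << e, nth 0 s i >> = 0) -> orthonormal_seq (rcons s e).
Proof.
move=> [Ls os] Le e1 es; split=> [i|i j]; rewrite !size_rcons !ltnS !nth_rcons.
  by rewrite leq_eqVlt => /predU1P[->|il]; rewrite ?ltnn ?eqxx// il; exact: Ls.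
rewrite leq_eqVlt => /predU1P[->|il]; rewrite leq_eqVlt => /predU1P[->|jl];
  rewrite ?ltnn ?eqxx ?il ?jl//.
- by rewrite es// gtn_eqF.
- by rewrite L2_dotC es// ltn_eqF.
- exact: os.
Qed.

Lemma residual_dot s e f : orthonormal_seq s -> L2 f -> L2 e ->
  (forall i, (i < size s)%N -> << e, nth 0 s i >> = 0) ->
  << residual s f, e >> = << f, e >>.
Proof.
move=> [Ls _] Lf Le es; have Le' (i : 'I_(size s)) : L2 (entry i) by exact: Ls.
rewrite L2_dotBl//; last exact: L2_diag.
rewrite L2_dot_comb// big1 ?subr0// => i _.
by rewrite [<< entry _, _ >>]L2_dotC es ?mulr0.
Qed.

Lemma residual0_rcons s e f : orthonormal_seq s -> L2 f -> L2 e ->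
  << e, e >> = 1 ->
  (forall i, (i < size s)%N -> << e, nth 0 s i >> = 0) ->
  norm (residual s f) = 0 -> norm (residual (rcons s e) f) = 0.
Proof.
move=> on Lf Le e1 es f0.
have on' := orthonormal_rcons on Le e1 es.
have L' := L2_residual on' Lf; have L'' := L2_residual on Lf.
apply/eqP; rewrite eq_le L2_norm_ge0 andbT -f0 !L2_normE// ler_wsqrtr//.
rewrite residual_rcons.
have Lee : L2 (<< f, e >> *: e) by exact: L2Z.
rewrite -(residual_dot on Lf Le es).
set r := residual s f; rewrite L2_dot_sqrB//; last exact: L2Z.
rewrite L2_dotZr ?L2_dotZl ?L2_dotZr// ?e1; last exact: L2Z.
have := sqr_ge0 << r, e >>; rewrite expr2; lra.
Qed.

Variable w : nat -> T -> R.
Hypothesis Lw : forall n, L2 (w n).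
Hypothesis w_total : forall f (e : R), L2 f -> 0 < e ->
  exists n (c : 'I_n -> R), norm (f - \sum_(i < n) c i *: w i) < e.
Hypothesis infinite_dim : forall s, orthonormal_seq s ->
  exists2 f, L2 f & norm (residual s f) != 0.

Lemma residual_w s : orthonormal_seq s -> exists m, norm (residual s (w m)) != 0.
Proof.
move=> on; apply: contrapT => nw; have [f Lf f0] := infinite_dim on.
have w0 m : norm (residual s (w m)) = 0.
  by apply/eqP/negPn/negP => wm; apply: nw; exists m.
have fgt0 : 0 < norm (residual s f) by rewrite lt_def f0 L2_norm_ge0.
have [n [c]] := w_total Lf fgt0; apply/negP; rewrite -leNgt.
apply: residual_best => //; first by apply: L2_sum => i _; exact: L2Z.
exact: (residual_comb on c (a := fun i : 'I_n => w i)).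
Qed.

(** The last condition is the progress made by one step of Gram-Schmidt; through it
    all terms of [w] enter the spans one after the other. *)
Definition extends s s' := exists e, [/\ s' = rcons s e, orthonormal_seq s' &
  forall m, (forall k, (k < m)%N -> norm (residual s (w k)) = 0) ->
    norm (residual s' (w m)) = 0].

(** The new vector is the normalized residual of the first [w m] outside of the
    span; earlier terms are already in the span, and this one enters it. *)
Lemma extension s : orthonormal_seq s -> exists s', extends s s'.
Proof.
move=> on.
have [m0 m0P m0min] := ex_minnP (residual_w on).
have Lm0 := L2_residual on (Lw m0).
have r0 : 0 < norm (residual s (w m0)) by rewrite lt_def m0P L2_norm_ge0.
pose e := (norm (residual s (w m0)))^-1 *: residual s (w m0).
have Le : L2 e by exact: L2Z.
have e1 : << e, e >> = 1.
  rewrite L2_dotZl// L2_dotZr// -L2_norm_sqr//.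
  by field; rewrite gt_eqF.
have es i : (i < size s)%N -> << e, nth 0 s i >> = 0.
  move=> il; rewrite L2_dotZl//; last by case: on => Ls _; exact: Ls.
  by rewrite (residual_orth on (Ordinal il))// mulr0.
have on' := orthonormal_rcons on Le e1 es.
exists (rcons s e), e; split => // m wm.
have [mm0|mm0] := ltnP m m0.
  apply: residual0_rcons => //; apply/eqP/negPn/negP => /m0min.
  by rewrite leqNgt mm0.
have {wm mm0} -> : m = m0.
  apply/eqP; rewrite eqn_leq mm0 andbT leqNgt; apply/negP => /wm m00.
  by move: m0P; rewrite m00 eqxx.
set r := residual s (w m0) in Lm0 r0 e Le e1 es on' *.
rewrite residual_rcons -(residual_dot on (Lw m0) Le es) -/r.
have -> : << r, e >> = norm r.
  by rewrite L2_dotZr// -L2_norm_sqr// expr2 mulrA mulVf ?mul1r// gt_eqF.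
rewrite scalerA divff ?gt_eqF// scale1r subrr L2_normE ?L2_dot0l ?sqrtr0//.
exact: L2_0.
Qed.

Variable s0 : seq (T -> R).
Hypothesis on0 : orthonormal_seq s0.

(** After [n] steps the first [n] terms of [w] are in the span, so the error of the
    partial sums is at most the distance from [f] to the combinations of these terms. *)
Theorem orthonormal_completion : exists psi : nat -> T -> R,
  [/\ forall i, L2 (psi i),
      forall i j, << psi i, psi j >> = (i == j)%:R,
      forall i, (i < size s0)%N -> psi i = nth 0 s0 i &
      forall f, L2 f ->
        L2_cvg mu (fun n => \sum_(i < n) << f, psi i >> *: psi i) f].
Proof.
have ext s : exists s', orthonormal_seq s -> extends s s'.
  have [on|non] := pselect (orthonormal_seq s); last by exists s.
  by have [s' ?] := extension on; exists s'.
have [nxt nxtP] := choice ext.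
pose S n := iter n nxt s0.
have onS n : orthonormal_seq (S n).
  by elim: n => //= n IH; have [e [_ ]] := nxtP _ IH.
have SS n : extends (S n) (S n.+1) by exact: nxtP.
have szS n : size (S n) = (n + size s0)%N.
  by elim: n => // n IH; have [e [-> _ _]] := SS n; rewrite size_rcons IH.
have nthS n k i : (i < size (S n))%N -> nth 0 (S (k + n)%N) i = nth 0 (S n) i.
  move=> i_n; elim: k => // k IH; have [e [E _ _]] := SS (k + n)%N.
  rewrite addSn E.
  rewrite nth_rcons szS -[X in (_ < X)%N]addnA -szS ifT ?IH//.
  by rewrite (leq_trans i_n)// leq_addl.
(* The entry of index i has settled after i + 1 steps, whatever the size of s0. *)
pose psi i := nth 0 (S i.+1) i.
have psiE n i : (i < size (S n))%N -> psi i = nth 0 (S n) i.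
  move=> i_n; have i1 : (i < size (S i.+1))%N by rewrite szS leq_addr.
  by rewrite /psi -(nthS _ n _ i1) -(nthS _ i.+1 _ i_n) addnC.
have big i j : (i < size (S (maxn i j).+1))%N /\ (j < size (S (maxn i j).+1))%N.
  by rewrite szS; split; rewrite addSn ltnS (leq_trans _ (leq_addr _ _))//
    ?leq_maxl ?leq_maxr.
have inS n k : (k < n)%N -> norm (residual (S n) (w k)) = 0.
  elim: n k => // n IH k kn; have [e [E onE wE]] := SS n.
  have := kn; rewrite ltnS leq_eqVlt => /predU1P[->|{}kn]; first exact: wE.
  rewrite E in onE *.
  have sn : (size (S n) < size (rcons (S n) e))%N by rewrite size_rcons.
  apply: residual0_rcons => //; [| | |exact: IH].
  - by have := onE.1 _ sn; rewrite nth_rcons ltnn eqxx.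
  - by have := onE.2 _ _ sn sn; rewrite nth_rcons ltnn eqxx.
  - move=> i il; have := onE.2 _ _ sn (ltn_trans il sn).
    by rewrite !nth_rcons ltnn eqxx il gtn_eqF.
exists psi; split.
- by move=> i; apply: (onS i.+1).1; rewrite szS leq_addr.
- move=> i j; have [bi bj] := big i j.
  by rewrite (psiE _ _ bi) (psiE _ _ bj); apply: (onS _).2.
- by move=> i il; rewrite (psiE 0%N).
move=> f Lf; apply/cvgr0Pnorm_lt => e e0.
have [n [c fc]] := w_total Lf e0.
exists (n + size s0)%N => // m /= nm; rewrite ger0_norm ?L2_norm_ge0//.
pose k := (m - size s0)%N.
have mE : m = size (S k) by rewrite szS subnK// (leq_trans _ nm)// leq_addl.
have nk : (n <= k)%N by rewrite leq_subRL 1?addnC// (leq_trans _ nm)// leq_addl.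
have -> : \sum_(i < m) << f, psi i >> *: psi i - f = - residual (S k) f.
  rewrite opprB; congr (_ - _); rewrite mE; apply: eq_bigr => i _.
  by rewrite mul1r (psiE k).
rewrite -scaleN1r L2_normZ ?normrN1 ?mul1r; last exact: L2_residual.
apply: le_lt_trans fc; apply: (residual_best (onS k) Lf).
  by apply: L2_sum => i _; exact: L2Z.
apply: (residual_comb (onS k) c (a := fun i : 'I_n => w i)) => // i.
by apply: inS; exact: leq_trans nk.
Qed.

End gram_schmidt.

(** * Total sequences of step functions *)

Lemma L2_bounded d (T : measurableType d) (R : realType)
    (mu : {measure set T -> \bar R}) (f : T -> R) (C : R) :
  mu setT \is a fin_num -> measurable_fun setT f -> (forall s, `|f s| <= C) ->
  L2 mu f.
Proof.
move=> muT mf fC; rewrite /Defs.L2/= inE/=; apply/andP; split; rewrite inE//=.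
have C0 : 0 <= C by rewrite (le_trans _ (fC point))//.
rewrite /finite_norm unlock poweR_lty//.
apply: (@le_lt_trans _ _ (\int[mu]_x (C `^ 2)%:E)%E).
  apply: ge0_le_integral => //.
  - by move=> s _; exact: poweR_ge0.
  - apply: (@measurableT_comp _ _ _ _ _ _ (fun y : \bar R => y `^ 2)%E).
      exact: measurable_poweR.
    by apply: measurableT_comp => //; exact/measurable_EFinP.
  - by move=> s _; rewrite /= lee_fin ge0_ler_powR// nnegrE.
by rewrite integral_cst// lte_mul_pinfty ?lee_fin ?powR_ge0// -ge0_fin_numE.
Qed.

Section finite_measure_L2.
Context d (T : measurableType d) (R : realType).
Variable mu : {finite_measure set T -> \bar R}.
Local Notation L2 := (L2 mu).
Local Notation norm := (L2_norm mu).
Local Notation "<< f , g >>" := (L2_dot mu f g).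

Lemma L2_indic (A : set T) : measurable A -> L2 (\1_A).
Proof.
move=> mA; apply: (@L2_bounded _ _ _ _ _ 1) => // [|s]; first exact: fin_num_measure.
by rewrite indicE; case: (_ \in _); rewrite /= ?normr1 ?normr0.
Qed.

Lemma L2_dot_indic (A B : set T) : measurable A -> measurable B ->
  << \1_A, \1_B >> = fine (mu (A `&` B)).
Proof.
move=> mA mB; rewrite /L2_dot /Rintegral; congr fine.
have := @integral_indic _ _ _ mu setT measurableT _ (measurableI _ _ mA mB).
rewrite setIT => <-; by apply: eq_integral => s _; rewrite indicI.
Qed.

Lemma norm_indic (A : set T) : measurable A -> norm \1_A ^+ 2 = fine (mu A).
Proof. by move=> mA; rewrite L2_norm_sqr ?L2_dot_indic ?setIid//; exact: L2_indic. Qed.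

Lemma indicD_sub (A B : set T) : B `<=` A -> (\1_A - \1_B : T -> R) = \1_(A `\` B).
Proof.
move=> BA; apply/funext => s; rewrite !fctE !indicE in_setD.
have [sB|sB] := boolP (s \in B); last by rewrite subr0 andbT.
by rewrite (mem_set (BA _ (set_mem sB))) subrr.
Qed.

Variable w : nat -> T -> R.
Hypothesis Lw : forall n, L2 (w n).

(** The family of coefficients is eventually 0 past [n]; letting every larger bound
    represent [f] makes sums immediate. *)
Definition seq_span : set (T -> R) := [set f | exists (c : nat -> R) (n : nat),
  forall m, (n <= m)%N -> f = \sum_(i < m) c i *: w i].

Lemma seq_span_lin (k : R) f g : seq_span f -> seq_span g -> seq_span (k *: f + g).
Proof.
move=> [c [n fc]] [e [m ge]]; exists (fun i => k * c i + e i), (maxn n m) => p.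
rewrite geq_max => /andP[np mp]; rewrite (fc _ np) (ge _ mp) scaler_sumr -big_split.
by apply: eq_bigr => i _ /=; rewrite scalerDl scalerA.
Qed.

Lemma seq_span_term n : seq_span (w n).
Proof.
exists (fun i => (i == n)%:R), n.+1 => m nm.
rewrite (bigD1 (Ordinal nm))//= eqxx scale1r big1 ?addr0// => i.
by rewrite -val_eqE/= => /negPf ->; rewrite scale0r.
Qed.

Lemma seq_span_L2 f : seq_span f -> L2 f.
Proof.
by move=> [c [n /(_ n (leqnn n)) ->]]; apply: L2_sum => i _; exact: L2Z.
Qed.

Definition closed_span := L2_closure mu seq_span.

Lemma closed_span_term n : closed_span (w n).
Proof.
split => // e e0; exists (w n); first exact: seq_span_term.
by rewrite subrr L2_normE ?L2_dot0l ?sqrtr0//; exact: L2_0.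
Qed.

Lemma closed_span_lin (k : R) f g : closed_span f -> closed_span g -> closed_span (k *: f + g).
Proof.
move=> [Lf fc] [Lg gc]; split; first exact: L2_lin.
move=> e e0; have k0 : 0 < `|k| + 1 by rewrite ltr_wpDl.
have [f' f's ff'] := fc (e / 2 / (`|k| + 1)) (divr_gt0 (divr_gt0 e0 (ltr0Sn R 1)) k0).
have [g' g's gg'] := gc (e / 2) (divr_gt0 e0 (ltr0Sn R 1)).
exists (k *: f' + g'); first exact: seq_span_lin.
have Lf' := seq_span_L2 f's; have Lg' := seq_span_L2 g's.
have -> : k *: f + g - (k *: f' + g') = k *: (f - f') + (g - g').
  by rewrite scalerBr opprD addrACA.
rewrite (le_lt_trans (L2_minkowski _ _))//; [by apply: L2Z; exact: L2B|exact: L2B|].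
rewrite L2_normZ; last exact: L2B.
rewrite [ltRHS]splitr ler_ltD//.
have : (`|k| + 1) * norm (f - f') < e / 2 by rewrite mulrC -ltr_pdivlMr.
by move/ltW; apply: le_trans; rewrite ler_wpM2r ?L2_norm_ge0// lerDl.
Qed.

Lemma closed_span0 : closed_span 0.
Proof.
by have := closed_span_lin (-1) (closed_span_term 0) (closed_span_term 0); rewrite scaleN1r addNr.
Qed.

Lemma closed_spanZ (k : R) f : closed_span f -> closed_span (k *: f).
Proof. by move=> fc; rewrite -[_ *: _]addr0; apply: closed_span_lin => //; exact: closed_span0. Qed.

Lemma closed_spanB f g : closed_span f -> closed_span g -> closed_span (f - g).
Proof. by move=> ? ?; rewrite -scaleN1r addrC; exact: closed_span_lin. Qed.

Lemma closed_span_sum (I : Type) (r : seq I) (P : pred I) (F : I -> T -> R) :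
  (forall i, P i -> closed_span (F i)) -> closed_span (\sum_(i <- r | P i) F i).
Proof.
move=> LF; elim/big_ind: _ => //; first exact: closed_span0.
by move=> f g ? ?; rewrite -[f]scale1r; exact: closed_span_lin.
Qed.

Lemma closed_span_closed f : L2 f ->
  (forall e : R, 0 < e -> exists2 h, closed_span h & norm (f - h) < e) -> closed_span f.
Proof.
move=> Lf fc; split => // e e0.
have [h [Lh hc] fh] := fc (e / 2) (divr_gt0 e0 (ltr0Sn R 1)).
have [g gs hg] := hc (e / 2) (divr_gt0 e0 (ltr0Sn R 1)).
exists g => //; have Lg := seq_span_L2 gs.
rewrite -(subrKA h) [ltRHS]splitr.
rewrite (le_lt_trans (L2_minkowski _ _)) ?ltrD//; exact: L2B.
Qed.

Lemma closed_span_cvg f (h : nat -> T -> R) : L2 f -> (forall n, closed_span (h n)) ->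
  << f - h n, f - h n >> @[n --> \oo] --> 0 -> closed_span f.
Proof.
move=> Lf hc /cvgr0_norm_lt hf; apply: closed_span_closed => // e e0.
have [n _ /(_ n (leqnn n))] := hf (e ^+ 2) (exprn_gt0 2 e0).
have Lfh : L2 (f - h n) by apply: L2B => //; case: (hc n).
rewrite ger0_norm ?L2_dot_ge0// -L2_norm_sqr// => fn.
exists (h n) => //; rewrite -(ltr_pXn2r (n := 2)) ?nnegrE ?L2_norm_ge0//.
exact: ltW.
Qed.

(** The squared distance from the indicator of the union to that of the [n] first
    sets is the measure of the rest, which tends to 0. *)
Lemma closed_span_bigcup (F : (set T)^nat) : (forall n, measurable (F n)) ->
  trivIset setT F -> (forall n, closed_span \1_(F n)) ->
  closed_span \1_(\bigcup_n F n).
Proof.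
move=> mF tF cF; have mU : measurable (\bigcup_n F n) by exact: bigcup_measurable.
pose h n : T -> R := \sum_(i < n) \1_(F i).
have hE n : h n = \1_(\big[setU/set0]_(i < n) F i).
  rewrite /h; elim: n => [|n IH].
    by rewrite !big_ord0; apply/funext => s; rewrite indicE in_set0.
  rewrite !big_ord_recr/= IH; set A := \big[_/_]_(_ < _) _.
  have AF : A `&` F n = set0.
    rewrite /A -bigcup_mkord; apply/seteqP; split => // s [[i /= il Fi] Fn].
    by have := tF i n I I (ex_intro _ s (conj Fi Fn)) => iE; rewrite iE ltnn in il.
  apply/funext => s; rewrite !fctE !indicE in_setU.
  have [sA|sA] := boolP (s \in A); last by rewrite add0r.
  rewrite (_ : s \in F n = false) ?addr0//; apply/negP => sF.
  by rewrite !inE in sA sF; rewrite -[False]/(set0 s) -AF.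
apply: (@closed_span_cvg _ h).
- exact: L2_indic.
- by move=> n; apply: closed_span_sum => i _; exact: cF.
have mB n : measurable (\big[setU/set0]_(i < n) F i).
  by rewrite -bigcup_mkord; exact: bigcup_measurable.
have E n : << \1_(\bigcup_n F n) - h n, \1_(\bigcup_n F n) - h n >> =
    fine (mu (\bigcup_n F n)) - fine (\sum_(0 <= i < n) mu (F i))%E.
  rewrite hE indicD_sub; last by rewrite -bigcup_mkord => s [i _ Fi]; exists i.
  rewrite L2_dot_indic ?setIid; try exact: measurableD.
  rewrite measureD// ?fineB ?fin_num_measure//; [|exact: measurableI|by rewrite -ge0_fin_numE ?fin_num_measure].
  congr (_ - fine _).
  rewrite setIidr; last by rewrite -bigcup_mkord => s [i _ Fi]; exists i.
  rewrite measure_bigsetU//.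
  by rewrite big_mkord.
rewrite (funext E).
have cF' : fine (\sum_(0 <= i < n) mu (F i))%E @[n --> \oo] --> fine (mu (\bigcup_n F n)).
  apply: fine_cvg; rewrite fineK ?fin_num_measure//.
  exact: measure_semi_sigma_additive.
have := cvgB (cvg_cst (fine (mu (\bigcup_n F n)))) cF'.
by rewrite subrr; apply.
Qed.

Import HBNNSimple.

(** The simple functions increasing to [f] converge in L^2 by dominated convergence,
    with [f ^+ 2] dominating the squared errors. *)
Lemma closed_span_nonneg : (forall A, measurable A -> closed_span \1_A) ->
  forall f, L2 f -> (forall s, 0 <= f s) -> closed_span f.
Proof.
move=> cA f Lf f0; have mf := L2_measurable Lf.
have mEf : measurable_fun setT (EFin \o f) by exact/measurable_EFinP.
have Ef0 s : setT s -> (0 <= (EFin \o f) s)%E by move=> _; rewrite lee_fin.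
pose h n : T -> R := nnsfun_approx measurableT mEf n.
have hf n s : 0 <= h n s <= f s.
  rewrite fun_ge0/= -lee_fin /h nnsfun_approxE.
  exact: le_approx.
have ch n : closed_span (h n).
  have -> : h n = \sum_(y <- finmap.enum_fset (fset_set (range (h n)))) y *: \1_(h n @^-1` [set y]).
    by apply/funext => s; rewrite fct_sumE {1}/h fimfunE fsbig_finite.
  by apply: closed_span_sum => y _; apply: closed_spanZ; exact: cA.
apply: (@closed_span_cvg _ h) => //.
have Lh n : L2 (h n) by case: (ch n).
have cvh s : h n s @[n --> \oo] --> f s.
  exact: fine_cvg (@cvg_nnsfun_approx _ _ _ _ measurableT _ mEf Ef0 s I).
pose F n s := ((f s - h n s) * (f s - h n s))%:E.
have Ffh n : (\int[mu]_s F n s)%E = (<< f - h n, f - h n >>)%:E.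
  rewrite /L2_dot /Rintegral fineK//; apply: integrable_fin_num => //.
  by apply: L2_integrableM; exact: L2B.
have mF n : measurable_fun setT (F n).
  by apply: measurable_int (L2_integrableM (L2B Lf (Lh n)) (L2B Lf (Lh n))).
have [||||_ _] := @dominated_convergence _ _ _ mu setT measurableT
  F (cst 0%E) (fun s => (f s * f s)%:E) mF.
- exact: measurable_cst.
- apply: aeW => s _; rewrite /F /=; apply: cvg_EFin; first exact: nearW.
  have cvd : f s - h n s @[n --> \oo] --> (0 : R).
    by rewrite -(subrr (f s)); apply: cvgB => //; exact: cvg_cst.
  by have := cvgM cvd cvd; rewrite mulr0; apply.
- exact: (L2_integrableM Lf Lf).
- apply: aeW => s n _; rewrite /F lee_fin.
  have /andP[h0 hfs] := hf n s.
  rewrite normrM ger0_norm ?subr_ge0// ler_pM ?subr_ge0//; lra.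
rewrite integral0 => /fine_cvg.
by rewrite (_ : fine \o _ = (fun n => << f - h n, f - h n >>))//; apply/funext => n /=; rewrite Ffh.
Qed.

Lemma closed_span_total : (forall A, measurable A -> closed_span \1_A) ->
  forall f, L2 f -> closed_span f.
Proof.
move=> cA f Lf.
have La : L2 (fun s => `|f s|).
  have mf := L2_measurable Lf.
  move: Lf; rewrite /Defs.L2/= !inE/= => /andP[_ ]; rewrite !inE/= => f2.
  apply/andP; split; rewrite inE/=; first exact: measurableT_comp.
  by move: f2; rewrite /finite_norm -Lnorm_abse.
have -> : f = (fun s => `|f s|) - ((fun s => `|f s|) - f) by rewrite opprB addrC subrK.
apply: closed_spanB; apply: closed_span_nonneg => //; first exact: L2B.
by move=> s; rewrite !fctE subr_ge0 ler_norm.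
Qed.

End finite_measure_L2.

(** The comparison with the Lebesgue measure makes short intervals small, which gives
    both the density of the rays with rational end point and the absence of a
    finite basis. *)
Section line.
Context (R : realType).
Notation T := (measurableTypeR R).
Variable mu : {finite_measure set T -> \bar R}.
Variable M : R.
Hypothesis mu_le : forall A : set T, measurable A -> (mu A <= M%:E * lebesgue_measure A)%E.
Local Notation L2 := (L2 mu).
Local Notation norm := (L2_norm mu).
Local Notation "<< f , g >>" := (L2_dot mu f g).

Definition ray (q : option rat) : set T :=
  if q is Some q then `]ratr q, +oo[%classic else setT.

Definition ray_indic (n : nat) : T -> R :=
  \1_(ray (odflt None (@unpickle (option rat) n))).

Lemma measurable_ray q : measurable (ray q).
Proof. by case: q => [q|]; [exact: measurable_itv|exact: measurableT]. Qed.

Lemma L2_ray n : L2 (ray_indic n).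
Proof. by apply: L2_indic; exact: measurable_ray. Qed.

Lemma ray_closed_span q : closed_span mu ray_indic \1_(ray q).
Proof.
have -> : \1_(ray q) = ray_indic (pickle q) by rewrite /ray_indic pickleK.
exact: closed_span_term L2_ray _.
Qed.

Lemma measure_itv_le (a b : R) : a <= b -> fine (mu `]a, b]%classic) <= M * (b - a).
Proof.
move=> ab; have mi : measurable (`]a, b]%classic : set T) by exact: measurable_itv.
rewrite -lee_fin fineK ?fin_num_measure//; apply: le_trans (mu_le mi) _.
rewrite lebesgue_measure_itv/= lte_fin.
have [_|ba] := ltP a b; first by rewrite -EFinD -EFinM.
by rewrite mule0 (_ : b - a = 0) ?mulr0//; apply/eqP; rewrite subr_eq0 eq_le ab ba.
Qed.

Lemma dominating_ge0 : 0 <= M.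
Proof.
have := measure_itv_le (@ler01 R); rewrite subr0 mulr1; apply: le_trans.
by rewrite fine_ge0.
Qed.

(** A ray with real end point is approximated by one with a nearby rational end
    point: the difference is a short interval, whose measure is small. *)
Lemma open_ray_closed_span (x : R) : closed_span mu ray_indic (\1_(`]x, +oo[%classic : set T)).
Proof.
have mr (y : R) : measurable (`]y, +oo[%classic : set T) by exact: measurable_itv.
apply: (closed_span_closed L2_ray); first exact: L2_indic.
move=> e e0.
have M1 : 0 < M + 1 by rewrite ltr_wpDl// dominating_ge0.
have d0 : 0 < e ^+ 2 / (M + 1) by rewrite divr_gt0// exprn_gt0.
have [|q] := @rat_in_itvoo R x (x + e ^+ 2 / (M + 1)); first by rewrite ltrDl.
rewrite in_itv/= => /andP[xq qd]; exists (\1_(ray (Some q))); first exact: ray_closed_span.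
rewrite -(ltr_pXn2r (n := 2)) ?nnegrE ?L2_norm_ge0//; last exact: ltW.
rewrite indicD_sub; last first.
  by move=> s; rewrite /= !in_itv/= !andbT; exact: lt_trans.
have -> : `]x, +oo[%classic `\` ray (Some q) = `]x, ratr q]%classic.
  apply/seteqP; split => s /=; rewrite !in_itv/= !andbT.
    by move=> [-> /negP]; rewrite -leNgt.
  by move=> /andP[-> sq]; split => //; apply/negP; rewrite -leNgt.
rewrite norm_indic; last exact: measurable_itv.
apply: le_lt_trans (measure_itv_le (ltW xq)) _.
have : M * (ratr q - x) <= M * (e ^+ 2 / (M + 1)).
  by rewrite ler_wpM2l ?dominating_ge0// lerBlDl ltW.
move/le_lt_trans; apply; rewrite mulrA ltr_pdivrMr// mulrC ltr_pM2l ?exprn_gt0//.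
by rewrite ltrDl.
Qed.

(** The measurable sets whose indicator is in the closed span form a Dynkin class
    containing the open rays, a generating family stable by intersection. *)
Lemma indic_closed_span (A : set T) : measurable A -> closed_span mu ray_indic \1_A.
Proof.
have mE : @measurable _ T = <<s @RGenOInfty.G R >> by exact: RGenOInfty.measurableE.
move=> mA; apply: (dynkin_induction (P := fun A => closed_span mu ray_indic \1_A) mE).
- move=> _ _ [y ->] [z ->]; exists (Num.max y z).
  by apply/seteqP; split => s /=; rewrite !in_itv/= !andbT gt_max => /andP.
- exact: (ray_closed_span None).
- by move=> _ [y ->]; exact: open_ray_closed_span.
- move=> S mS cS; rewrite -setTD -indicD_sub//; apply: (closed_spanB L2_ray) => //.
  exact: (ray_closed_span None).
- by move=> F mF tF cF; exact: (closed_span_bigcup L2_ray).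
- by rewrite -mE.
Qed.

Lemma rays_total (f : T -> R) (e : R) : L2 f -> 0 < e ->
  exists n (c : 'I_n -> R), norm (f - \sum_(i < n) c i *: ray_indic i) < e.
Proof.
move=> Lf e0; have [_ /(_ e e0)] := closed_span_total L2_ray indic_closed_span Lf.
move=> [g [c [n /(_ n (leqnn n)) ->]] fg].
by exists n, (fun i => c i).
Qed.

Hypothesis mu01 : (0 < mu `]0%R, 1%R]%classic)%E.

Lemma mu_subdivision (m : nat) (k : nat) : (0 < m)%N ->
  fine (mu `]0, k%:R / m%:R]%classic) =
  \sum_(j < k) fine (mu `]j%:R / m%:R, j.+1%:R / m%:R]%classic).
Proof.
move=> m0; have mm : 0 < m%:R :> R by rewrite ltr0n.
elim: k => [|k IH].
  by rewrite big_ord0 mul0r set_itv_ge ?bnd_simp ?ltxx// measure0.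
rewrite big_ord_recr/= -IH.
have k0 : 0 <= k%:R / m%:R :> R by rewrite divr_ge0.
have kk : k%:R / m%:R <= k.+1%:R / m%:R :> R by rewrite ler_pM2r ?invr_gt0// ler_nat.
rewrite (@itv_bndbnd_setU _ _ _ (BRight (k%:R / m%:R))) ?bnd_simp//.
rewrite measureU//=; try exact: measurable_itv; last first.
  apply/seteqP; split => // s /=; rewrite !in_itv/= => -[/andP[_ sk] /andP[ks _]].
  by move: sk; rewrite leNgt ks.
by rewrite fineD// fin_num_measure//; exact: measurable_itv.
Qed.

(** If [s] spanned everything, the squared norm [<< f, f >>] of each [f] would be the
    sum of the squares of its coordinates along [s].  Cut ]0, 1] into [m] intervals
    of length 1 / m, each of measure at most M / m.  By Bessel's inequality for the
    indicators of these intervals, applied to the entries of [s], the number of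
    intervals of positive measure is at most the size of [s]; so the measure of
    ]0, 1] is at most (size s) M / m, which is false for large [m]. *)
Lemma L2_infinite_dim s : orthonormal_seq mu s ->
  exists2 f, L2 f & norm (residual mu s f) != 0.
Proof.
move=> on; apply: contrapT => nf.
have res0 f : L2 f -> << f, f >> = \sum_i << f, entry (s := s) i >> ^+ 2.
  move=> Lf; apply/eqP; rewrite -subr_eq0 -residual_sqr// -L2_norm_sqr; last exact: L2_residual.
  by rewrite sqrf_eq0; apply/negPn/negP => fn; apply: nf; exists f.
pose tot := fine (mu `]0, 1]%classic).
have mI (x y : R) : measurable (`]x, y]%classic : set T) by exact: measurable_itv.
have tot0 : 0 < tot by rewrite fine_gt0// mu01 -ge0_fin_numE ?fin_num_measure.
pose m := Num.bound ((size s)%:R * M / tot).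
have sM : 0 <= (size s)%:R * M / tot.
  by rewrite divr_ge0 ?mulr_ge0 ?dominating_ge0 ?ler0n// ltW.
have mP : (size s)%:R * M / tot < m%:R by exact: archi_boundP.
have m0 : (0 < m)%N by rewrite -(ltr_nat R) (le_lt_trans _ mP).
have mm : 0 < m%:R :> R by rewrite ltr0n.
pose I (j : 'I_m) : set T := `]j%:R / m%:R, j.+1%:R / m%:R]%classic.
pose b (j : 'I_m) : T -> R := \1_(I j).
have Lb j : L2 (b j) by apply: L2_indic; exact: mI.
have ob i j : i != j -> << b i, b j >> = 0.
  move=> ij; rewrite L2_dot_indic//; try exact: mI.
  rewrite (_ : I i `&` I j = set0) ?measure0//.
  apply/seteqP; split => // x /=; rewrite /I/= !in_itv/=.
  rewrite !ltr_pdivrMr// !ler_pdivlMr// => -[/andP[ix xi] /andP[jx xj]].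
  have := lt_le_trans ix xj; have := lt_le_trans jx xi; rewrite !ltr_nat !ltnS.
  move=> ji ij'; move/negP: ij; apply; apply/eqP/val_inj/eqP.
  by rewrite eqn_leq ij' ji.
have lamE j : << b j, b j >> = fine (mu (I j)).
  by rewrite L2_dot_indic ?setIid//; exact: mI.
have lamM j : << b j, b j >> <= M / m%:R.
  rewrite lamE; apply: le_trans (measure_itv_le _) _.
    by rewrite ler_pM2r ?invr_gt0// ler_nat.
  by rewrite -mulrBl -natrB// subSnn mul1r.
have totE : tot = \sum_j << b j, b j >>.
  rewrite /tot -[X in `]0, X]](@divff _ (m%:R : R)) ?gt_eqF// mu_subdivision//.
  by apply: eq_bigr => j _; rewrite lamE.
suff : tot <= M / m%:R * (size s)%:R.
  rewrite mulrAC ler_pdivlMr// leNgt => /negP; apply.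
  by move: mP; rewrite ltr_pdivrMr// mulrC [_ * m%:R]mulrC.
have -> : (size s)%:R = \sum_(i < size s) << entry (s := s) i, entry (s := s) i >>.
  rewrite (eq_bigr (fun=> 1)) ?sumr_const ?card_ord// => i _.
  by case: on => _ o; rewrite o// eqxx.
have Ls (i : 'I_(size s)) : L2 (entry i) by case: on => o _; exact: o.
have Mm0 : 0 <= M / m%:R by rewrite divr_ge0 ?dominating_ge0.
apply: (@le_trans _ _ (M / m%:R * \sum_(i < size s) \sum_j
    << b j, b j >>^-1 * << entry (s := s) i, b j >> ^+ 2)); last first.
  by rewrite ler_wpM2l// ler_sum// => i _; exact: bessel.
rewrite exchange_big/= mulr_sumr totE ler_sum// => j _.
rewrite -mulr_sumr (eq_bigr (fun i => << b j, entry (s := s) i >> ^+ 2)); last first.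
  by move=> i _; rewrite L2_dotC.
rewrite -res0//; have [->|l0] := eqVneq << b j, b j >> 0.
  by rewrite !mulr0.
by rewrite mulVf// mulr1.
Qed.

End line.

(** * Function spaces reproduced by a finite-rank kernel *)

Section finite_rank_rkhs.
Context (T : Type) (R : realType).
Variables (D : set T) (K : T -> T -> R) (N : nat) (b : 'I_N -> T -> R).
Hypothesis KE : forall s t, K s t = kernel_of b s t.
Hypothesis bD : forall i t, ~ D t -> b i t = 0.
Hypothesis ib : lin_indep b.

Let comb_supp c t : ~ D t -> comb c b t = 0.
Proof. by move=> Dt; rewrite combE big1// => i _; rewrite bD// mulr0. Qed.

Lemma kernel_comb t : K t = comb (fun i => b i t) b.
Proof. by apply/funext => s; rewrite KE combE. Qed.

Lemma comb_inj c e : comb c b = comb e b -> c = e.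
Proof.
move=> ce; apply/funext => i; apply/eqP; rewrite -subr_eq0; apply/eqP.
apply: (ib (c := fun i => c i - e i)) => s.
under eq_bigr do rewrite mulrBl.
by rewrite sumrB -!combE ce subrr.
Qed.

Section existence.

Let coord (F : T -> R) : 'I_N -> R := xget (fun=> 0) [set c | F = comb c b].

Let coordE c : coord (comb c b) = c.
Proof.
rewrite /coord; case: xgetP => [e -> /comb_inj//|/(_ c)].
by move=> /(_ erefl).
Qed.

Definition comb_space : set (T -> R) := [set F | exists c, F = comb c b].

(** The coordinates are those of the unique combination equal to the function. *)
Definition coord_dot F E := \sum_i coord F i * coord E i.

Lemma coord_dotE c e : coord_dot (comb c b) (comb e b) = \sum_i c i * e i.
Proof. by rewrite /coord_dot !coordE. Qed.

Let combB c e : comb c b - comb e b = comb (fun i => c i - e i) b.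
Proof.
by rewrite addrC -scaleN1r comb_lin; congr comb; apply/funext => i; ring.
Qed.

Lemma comb_space_rkhs : is_rkhs D K comb_space coord_dot.
Proof.
split.
- by move=> _ [c ->] t; exact: comb_supp.
- by exists (fun=> 0); rewrite /comb big1// => i _; rewrite scale0r.
- by move=> k _ _ [c ->] [e ->]; rewrite comb_lin; eexists.
- by move=> _ _ [c ->] [e ->]; rewrite !coord_dotE; apply: eq_bigr => i _; ring.
- move=> k _ _ _ [c ->] [e ->] [p ->]; rewrite comb_lin !coord_dotE mulr_sumr.
  by rewrite -big_split; apply: eq_bigr => i _ /=; ring.
- by move=> _ [c ->]; rewrite coord_dotE sumr_ge0// => i _; rewrite -expr2 sqr_ge0.
- move=> _ [c ->]; rewrite coord_dotE => /eqP.
  rewrite psumr_eq0 => [/allP c0|i _]; last by rewrite -expr2 sqr_ge0.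
  rewrite /comb big1// => i _; have := c0 i (mem_index_enum i).
  by rewrite mulf_eq0 orbb => /eqP ->; rewrite scale0r.
- move=> F VF FC; have [c Fc] := choice VF.
  have dist n m : Num.sqrt (coord_dot (F m - F n) (F m - F n)) =
      Num.sqrt (\sum_i (c m i - c n i) ^+ 2).
    by rewrite !Fc combB coord_dotE.
  have cl i : exists l : R, c n i @[n --> \oo] --> l.
    suff : cvgn (fun n => c n i) by move=> cc; exists (limn (fun n => c n i)).
    apply/cauchy_cvgP/cauchy_exP => e e0.
    have [n0 Fn0] := FC e e0; exists (c n0 i), n0 => // n nn.
    rewrite /ball/= (le_lt_trans _ (Fn0 n0 n _ _))// dist -sqrtr_sqr.
    rewrite ler_wsqrtr// (bigD1 i)//= lerDl sumr_ge0// => j _.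
    exact: sqr_ge0.
  have [l cvl] := choice cl.
  exists (comb l b); first by exists l.
  have -> : (fun n => Num.sqrt (coord_dot (F n - comb l b) (F n - comb l b))) =
      (fun n => Num.sqrt (\sum_i (c n i - l i) ^+ 2)).
    by apply/funext => n; rewrite !Fc combB coord_dotE.
  have cl0 i : c n i - l i @[n --> \oo] --> l i - l i.
    by apply: cvgB; [exact: cvl|exact: cvg_cst].
  have : \sum_i (c n i - l i) ^+ 2 @[n --> \oo] --> \sum_i (l i - l i) ^+ 2.
    by apply: (@cvg_sumr _ _ _ \oo) => i; exact: cvgM (cl0 i) (cl0 i).
  move/(continuous_cvg _ (@sqrt_continuous R _)).
  rewrite big1 ?sqrtr0// => i _; by rewrite subrr expr0n.
- by move=> t _; exists (fun i => b i t); exact: kernel_comb.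
- by move=> _ t [c ->] _; rewrite kernel_comb coord_dotE combE.
Unshelve. all: by end_near. Qed.

End existence.

(** The vectors of values [(b i t)_i] span the whole space, since a vector orthogonal
    to all of them is a linear relation between the [b i].  The proof selects
    points greedily: as long as fewer than [N] independent vectors are known, some
    value vector is not orthogonal to a given vector of their orthogonal complement. *)
Lemma spanning_values (X : set 'rV[R]_N) :
  (forall k u v, X u -> X v -> X (k *: u + v)) -> X 0 ->
  (forall t, D t -> X (\row_i b i t)) -> forall v, X v.
Proof.
move=> Xl X0 Xev.
have rows k : (k <= N)%N -> exists M : 'M[R]_(k, N), row_free M /\
    forall i, X (row i M).
  elim: k => [_|k IH kN].
    exists 0; split; last by move=> i; case: i.
    by apply: inj_row_free => v _; rewrite [v]thinmx0.
  have [M [fM XM]] := IH (ltnW kN).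
  have : kermx M^T != 0.
    rewrite -mxrank_eq0 mxrank_ker mxrank_tr.
    by move: fM; rewrite /row_free => /eqP ->; rewrite subn_eq0 -ltnNge.
  move=> /rowV0Pn[c /sub_kermxP cM c0].
  have [t bt] : exists t, \sum_i c 0 i * b i t != 0.
    apply: contrapT => nt; move/eqP: c0; apply; apply/rowP => i; rewrite mxE.
    apply: (ib (c := c 0)) => s; apply/eqP/negPn/negP => bs; apply: nt.
    by exists s.
  have Dt : D t.
    apply: contrapT => Dt; move: bt; rewrite big1 ?eqxx// => i _.
    by rewrite bD// mulr0.
  pose w : 'rV[R]_N := \row_i b i t.
  rewrite -[k.+1]addn1.
  exists (col_mx M w); split.
    apply: inj_row_free => v; rewrite -[v]hsubmxK mul_row_col.
    set v1 := lsubmx v; set v2 := rsubmx v => vM.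
    have v20 : v2 = 0.
      have := congr1 (fun A => A *m c^T) vM.
      rewrite mulmxDl -mulmxA mul0mx.
      have -> : M *m c^T = 0 by rewrite -[M *m _]trmxK trmx_mul trmxK cM trmx0.
      rewrite mulmx0 add0r (mx11_scalar v2) mul_scalar_mx -scalemxAl.
      move=> /matrixP/(_ 0 0); rewrite !mxE => /eqP; rewrite mulf_eq0.
      move=> /orP[/eqP ->|]; first by rewrite raddf0.
      rewrite (eq_bigr (fun i => c 0 i * b i t)) ?(negPf bt)// => i _.
      by rewrite !mxE mulrC.
    move: vM; rewrite v20 mul0mx addr0 => vM.
    have -> : v1 = 0 by apply: (row_free_inj fM); rewrite vM mul0mx.
    by rewrite row_mx0.
  move=> i; case: (split_ordP i) => j ->.
    by rewrite rowKu.
  by rewrite rowKd (ord1 j) row_id; exact: Xev.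
have [M [fM XM]] := rows N (leqnn N).
move=> v; have uM : M \in unitmx by rewrite -row_free_unit.
rewrite -[v](mulmxKV uM) mulmx_sum_row.
elim/big_ind: _ => // [u w Xu Xw|i _]; first by rewrite -[u]scale1r; exact: Xl.
by rewrite -[_ *: _]addr0; exact: Xl.
Qed.

Section uniqueness.
Variables (V : set (T -> R)) (ip : (T -> R) -> (T -> R) -> R).
Hypothesis rkhs : is_rkhs D K V ip.

Let V0 : V 0. Proof. exact: rkhs_zero rkhs. Qed.

(** The coefficient vectors of the combinations of [b] lying in [V] form a subspace
    containing all vectors of values, because [K t] is in [V]. *)
Lemma rkhs_features i : V (b i).
Proof.
suff /(_ (delta_mx 0 i)) : forall v : 'rV[R]_N, V (comb (v 0) b).
  have -> : comb ((delta_mx 0 i : 'rV[R]_N) 0) b = b i; last by [].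
  rewrite /comb (bigD1 i)//= mxE !eqxx scale1r big1 ?addr0// => j ji.
  by rewrite mxE (negPf ji) scale0r.
apply: spanning_values => [k u v Xu Xv||t Dt] /=.
- have -> : (k *: u + v) 0 = (fun i => k * u 0 i + v 0 i).
    by apply/funext => j; rewrite !mxE.
  by rewrite -comb_lin; exact: rkhs_closed rkhs _ _ _ Xu Xv.
- have -> // : comb ((0 : 'rV[R]_N) 0) b = 0.
  by rewrite /comb big1// => j _; rewrite mxE scale0r.
- have -> : (\row_i0 b i0 t) 0 = (fun j => b j t).
    by apply/funext => j; rewrite mxE.
  by rewrite -kernel_comb; exact: rkhs_kernel rkhs _ Dt.
Qed.

Lemma rkhs_comb c : V (comb c b).
Proof.
apply: (big_ind (fun F => V F)) => // [F E VF VE|i _].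
  by rewrite -[F]scale1r; exact: rkhs_closed rkhs _ _ _ VF VE.
by rewrite -[_ *: _]addr0; apply: (rkhs_closed rkhs) => //; exact: rkhs_features.
Qed.

Lemma rkhs_ip_combl c E : V E -> ip (comb c b) E = \sum_i c i * ip (b i) E.
Proof.
move=> VE.
have ip0 : ip 0 E = 0.
  have := rkhs_linear rkhs 1 V0 V0 VE; rewrite scale1r addr0 mul1r => /eqP.
  by rewrite -subr_eq0 opprD addNKr oppr_eq0 => /eqP.
have [VS ->] : V (comb c b) /\ ip (comb c b) E = \sum_i c i * ip (b i) E; last by [].
apply: (big_ind2 (fun F r => V F /\ ip F E = r)) => //.
  move=> F r G s [VF <-] [VG <-]; rewrite -[F]scale1r; split.
    exact: rkhs_closed rkhs _ _ _ VF VG.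
  by rewrite (rkhs_linear rkhs)// scale1r mul1r.
move=> i _; have Vb := rkhs_features i.
rewrite -[_ *: _]addr0; split; first exact: rkhs_closed rkhs _ _ _ Vb V0.
by rewrite (rkhs_linear rkhs)// ip0 addr0.
Qed.

(** The reproducing property with [K t = comb (fun i => b i t) b]. *)
Lemma rkhs_expand F t : V F -> F t = \sum_i ip (b i) F * b i t.
Proof.
move=> VF; have [Dt|Dt] := pselect (D t); last first.
  rewrite (rkhs_supp rkhs VF Dt) big1// => i _.
  by rewrite bD// mulr0.
rewrite -(rkhs_reproducing rkhs VF Dt) kernel_comb.
rewrite (rkhs_sym rkhs VF (rkhs_comb _)) rkhs_ip_combl//.
by apply: eq_bigr => i _; rewrite mulrC.
Qed.

(** Expand [b j] by [rkhs_expand] and compare coefficients. *)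
Lemma rkhs_features_orthonormal i j : ip (b i) (b j) = (i == j)%:R.
Proof.
have := @comb_inj (fun i => ip (b i) (b j)) (fun i => (i == j)%:R).
move=> /(_ _)/(congr1 (fun c => c i)); apply; apply/funext => t.
rewrite !combE -rkhs_expand; last exact: rkhs_features.
rewrite (bigD1 j)//= eqxx mul1r big1 ?addr0// => k /negPf ->.
by rewrite mul0r.
Qed.

Lemma rkhs_ip_comb c e : ip (comb c b) (comb e b) = \sum_i c i * e i.
Proof.
rewrite rkhs_ip_combl; last exact: rkhs_comb.
apply: eq_bigr => i _; congr *%R.
rewrite (rkhs_sym rkhs (rkhs_features i) (rkhs_comb _)) rkhs_ip_combl; last first.
  exact: rkhs_features.
rewrite (bigD1 i)//= rkhs_features_orthonormal eqxx mulr1 big1 ?addr0// => j ji.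
by rewrite rkhs_features_orthonormal (negPf ji) mulr0.
Qed.

Lemma rkhs_combP F : V F <-> exists c, F = comb c b.
Proof.
split=> [VF|[c ->]]; last exact: rkhs_comb.
exists (fun i => ip (b i) F); apply/funext => t.
by rewrite combE -rkhs_expand.
Qed.

End uniqueness.
End finite_rank_rkhs.

(** * Classes of functions in the reproduced space *)

Section rkhs_classes.
Context d (T : measurableType d) (R : realType).
Variable mu : {measure set T -> \bar R}.
Local Notation L2 := (L2 mu).
Local Notation "<< f , g >>" := (L2_dot mu f g).
Local Notation "f =ae g" := (f = g %[ae mu]) (at level 70).
Variables (N : nat) (b : 'I_N -> T -> R).
Hypothesis Lb : forall i, L2 (b i).
Hypothesis ob : forall i j, i != j -> << b i, b j >> = 0.
Local Notation lam p := (<< b p, b p >>).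
Variable L : (T -> R) -> T -> R.
Hypothesis LE : forall f, L2 f -> L f = diag_op mu b (fun=> 1) f.
Local Notation H := (L2_orth mu (null_space mu L)).
Local Notation proj := (diag_op mu b (fun p => (lam p)^-1)).
Local Notation Lsqrt := (diag_op mu b (fun p => (Num.sqrt (lam p))^-1)).
Variables (D : set T) (K : T -> T -> R).
Hypothesis KE : forall s t, K s t = kernel_of b s t.
Hypothesis bD : forall i t, ~ D t -> b i t = 0.
Hypothesis ib : lin_indep b.
Variables (V : set (T -> R)) (ip : (T -> R) -> (T -> R) -> R).
Hypothesis rkhs : is_rkhs D K V ip.

Lemma rkhs_sub_L2 : V `<=` L2.
Proof. by move=> F /(rkhs_combP KE bD ib rkhs)[c ->]; exact: L2_comb. Qed.

Lemma rkhs_image_H : rkhs_image mu V = H.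
Proof.
apply/seteqP; split=> f.
  move=> [Lf [F /(rkhs_combP KE bD ib rkhs)[c ->] fc]]; split => // a na.
  have [La] := na; have : null_space mu L a by [].
  rewrite (null_spaceE Lb ob LE) => -[_ a0] _.
  rewrite (@ae_eq_L2_dot _ _ _ _ f (comb c b) a a)//; [|exact: L2_comb|exact: ae_refl].
  by rewrite L2_dot_comb// big1// => p _; rewrite L2_dotC a0 mulr0.
move=> Hf; have [Lf _] := Hf; split => //.
exists (proj f); last exact: (H_proj Lb ob LE).
exact: (rkhs_comb KE bD ib rkhs).
Qed.

(** The representatives of [f] in [V] are the [comb c b] with
    [c p * lam p = << f, b p >>], which leaves [c p] free exactly when [lam p = 0];
    the norm is smallest when these [c p] are 0. *)
Lemma quot_norm_sqr f : H f ->
  quot_norm mu V ip f ^+ 2 = \sum_p ((lam p)^-1 * << f, b p >>) ^+ 2.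
Proof.
move=> Hf; have [Lf _] := Hf.
set S := \sum_p _; have S0 : 0 <= S by apply: sumr_ge0 => p _; exact: sqr_ge0.
suff -> : quot_norm mu V ip f = Num.sqrt S by rewrite sqr_sqrtr.
rewrite /quot_norm; set A := [set r | _].
have AS : A (Num.sqrt S).
  exists (proj f); split.
  - exact: (rkhs_comb KE bD ib rkhs).
  - exact: (H_proj Lb ob LE).
  - by rewrite (rkhs_ip_comb KE bD ib rkhs).
have lbS : lbound A (Num.sqrt S).
  move=> _ [F [/(rkhs_combP KE bD ib rkhs)[c ->] fc ->]].
  rewrite (rkhs_ip_comb KE bD ib rkhs) ler_wsqrtr//.
  apply: ler_sum => p _; rewrite -expr2.
  rewrite (ae_coord Lb p Lf (L2_comb c Lb) fc).
  rewrite comb_coord//.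
  have [->|l0] := eqVneq (lam p) 0; first by rewrite mulr0 mulr0 expr0n sqr_ge0.
  by rewrite mulrCA mulVf// mulr1.
apply/eqP; rewrite eq_le; apply/andP; split.
  by apply: ge_inf => //; exists (Num.sqrt S).
by apply: lb_le_inf => //; exists (Num.sqrt S).
Qed.

Lemma quot_dotE f h : H f -> H h ->
  quot_dot mu V ip f h = \sum_p (lam p)^-1 ^+ 2 * (<< f, b p >> * << h, b p >>).
Proof.
move=> Hf Hh; have [Lf _] := Hf; have [Lh _] := Hh.
rewrite /quot_dot !quot_norm_sqr//; last 2 first.
- exact: H_sub.
- by rewrite -[f]scale1r; exact: H_lin.
rewrite -sumrB mulr_suml; apply: eq_bigr => p _.
by rewrite L2_dotDl// L2_dotBl//; set l := (lam p)^-1; field.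
Qed.

Lemma dot_restr_inverse f h f' h' : restr_inverse mu Lsqrt H f f' ->
  restr_inverse mu Lsqrt H h h' ->
  L2_range mu Lsqrt f -> L2_range mu Lsqrt h ->
  << f', h' >> = \sum_p (lam p)^-1 ^+ 2 * (<< f, b p >> * << h, b p >>).
Proof.
move=> [Hf' _ uf] [Hh' _ uh] rf rh; have [Lf' _] := Hf'; have [Lh' _] := Hh'.
have Lf := rf.1; have Lh := rh.1.
have [Hf0 Ef0 _] := sqrt_restr_inverse Lb ob LE rf.
have [Hh0 Eh0 _] := sqrt_restr_inverse Lb ob LE rh.
rewrite -(ae_eq_L2_dot (L2_diag Lb _ f) Lf' (L2_diag Lb _ h) Lh' (uf _ Hf0 Ef0) (uh _ Hh0 Eh0)).
rewrite diag_dot//; last exact: L2_diag.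
apply: eq_bigr => p _; rewrite diag_coord//.
have [l0|l0] := eqVneq (lam p) 0; first by rewrite l0 invr0 expr0n/= !mul0r.
have := sqrt_lam_neq0 l0.
have : lam p = Num.sqrt (lam p) ^+ 2 by rewrite sqr_sqrtr// L2_dot_ge0.
by set r := Num.sqrt _ => -> r0; field.
Qed.

Theorem rkhs_classes_sqrt :
  [/\ V `<=` L2,
      rkhs_image mu V = L2_range mu Lsqrt,
      (forall phi, L2_range mu Lsqrt phi ->
         exists2 h, restr_inverse mu Lsqrt H phi h &
           quot_norm mu V ip phi ^+ 2 = << h, h >>),
      (forall phi psi h k,
         restr_inverse mu Lsqrt H phi h -> restr_inverse mu Lsqrt H psi k ->
         L2_range mu Lsqrt phi -> L2_range mu Lsqrt psi ->
         quot_dot mu V ip phi psi = << h, k >>) &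
      (forall phi psi, L2_range mu Lsqrt phi -> L2 psi ->
         quot_dot mu V ip phi (L psi) = << phi, psi >>)].
Proof.
have HE := H_range_sqrt Lb ob LE.
split.
- exact: rkhs_sub_L2.
- by rewrite -HE; exact: rkhs_image_H.
- move=> phi rphi; have ri := sqrt_restr_inverse Lb ob LE rphi.
  eexists; first exact: ri.
  rewrite (dot_restr_inverse ri ri rphi rphi) quot_norm_sqr ?HE//.
  by apply: eq_bigr => p _; ring.
- move=> phi psi h k hphi kpsi rphi rpsi.
  by rewrite (dot_restr_inverse hphi kpsi rphi rpsi) quot_dotE ?HE.
- move=> phi psi; rewrite -HE => Hphi Lpsi; have [Lphi _] := Hphi.
  rewrite quot_dotE//; last by rewrite LE//; exact: range_sub_H.
  rewrite (ae_eq_L2_dot Lphi (L2_diag Lb _ phi) Lpsi Lpsi (H_proj Lb ob LE Hphi) (ae_refl mu psi)).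
  rewrite diag_dot//; apply: eq_bigr => p _.
  rewrite LE// diag_coord// mul1r.
  have [l0|l0] := eqVneq (lam p) 0; first by rewrite l0 invr0 expr0n/= !mul0r.
  by field.
Qed.

End rkhs_classes.

(** * Eigenbases *)

Section eigenbasis_existence.
Context d (T : measurableType d) (R : realType).
Variable mu : {measure set T -> \bar R}.
Local Notation L2 := (L2 mu).
Local Notation norm := (L2_norm mu).
Local Notation "<< f , g >>" := (L2_dot mu f g).
Variables (N : nat) (b : 'I_N -> T -> R).
Hypothesis Lb : forall i, L2 (b i).
Hypothesis ob : forall i j, i != j -> << b i, b j >> = 0.
Local Notation lam p := (<< b p, b p >>).
Variable L : (T -> R) -> T -> R.
Hypothesis LE : forall f, L2 f -> L f = diag_op mu b (fun=> 1) f.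
Variable w : nat -> T -> R.
Hypothesis Lw : forall n, L2 (w n).
Hypothesis w_total : forall f (e : R), L2 f -> 0 < e ->
  exists n (c : 'I_n -> R), norm (f - \sum_(i < n) c i *: w i) < e.
Hypothesis infinite_dim : forall s, orthonormal_seq mu s ->
  exists2 f, L2 f & norm (residual mu s f) != 0.

(** Complete the normalized non-null [b p] to an orthonormal basis: the added
    functions are orthogonal to all [b p], hence in the null space of [L]. *)
Lemma eigenbasis_exists : exists l psi, eigenbasis mu L l psi.
Proof.
pose e p := (Num.sqrt (lam p))^-1 *: b p.
have Le p : L2 (e p) by exact: L2Z.
pose ps := [seq p <- enum 'I_N | lam p != 0].
pose s0 := [seq e p | p <- ps].
have nthE p0 i : (i < size ps)%N -> nth 0 s0 i = e (nth p0 ps i).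
  by move=> il; rewrite (nth_map p0).
have ps_lam p : p \in ps -> lam p != 0 by rewrite mem_filter => /andP[].
have szE : size s0 = size ps by rewrite size_map.
have on0 : orthonormal_seq mu s0.
  split=> [i|i j]; rewrite szE => il.
    have p0 : 'I_N by case: (ps) il => // p.
    by rewrite (nthE p0).
  move=> jl; have p0 : 'I_N by case: (ps) il => // p.
  rewrite !(nthE p0)// -(nth_uniq p0 il jl); last by rewrite filter_uniq ?enum_uniq.
  set p := nth p0 ps i; set q := nth p0 ps j.
  rewrite L2_dotZl// L2_dotZr//; have [<-|pq] := eqVneq p q; last by rewrite (ob pq) !mulr0.
  have l0 : lam p != 0 by apply: ps_lam; exact: mem_nth.
  rewrite mulrA -invfM -expr2 sqr_sqrtr ?L2_dot_ge0//.
  by rewrite mulVf.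
have [psi [Lpsi opsi psi0 cpsi]] := orthonormal_completion Lw w_total infinite_dim on0.
suff eig i : exists l : R, L (psi i) = l *: psi i %[ae mu].
  by have [l lP] := choice eig; exists l, psi.
have [il|il] := ltnP i (size ps).
  have p0 : 'I_N by case: (ps) il => // p.
  rewrite psi0 ?szE// (nthE p0)//; set p := nth _ _ _.
  exists (lam p); rewrite LE// -[e p]addr0 diag_lin//; last exact: L2_0.
  rewrite -!LE//; last exact: L2_0.
  have L0 : L 0 = 0.
    rewrite LE; last exact: L2_0.
    by rewrite /diag_op /comb big1// => q _; rewrite L2_dot0l mulr0 scale0r.
  rewrite (diag_eigenvector Lb ob LE) L0.
  by rewrite !addr0 !scalerA mulrC; exact: ae_refl.
exists 0; rewrite scale0r.
suff c0 p : << psi i, b p >> = 0.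
  rewrite LE// /diag_op /comb big1; first exact: ae_refl.
  by move=> p _; rewrite c0 mulr0 scale0r.
have [l0|l0] := eqVneq (lam p) 0; first exact: (coord_lam0 Lb (Lpsi i) l0).
have pps : p \in ps by rewrite mem_filter l0 mem_enum.
have ip : (index p ps < size ps)%N by rewrite index_mem.
have : << psi i, psi (index p ps) >> = 0.
  by rewrite opsi gtn_eqF//; exact: leq_trans il.
rewrite (psi0 (index p ps)) ?szE// (nthE p)// nth_index// L2_dotZr// => /eqP.
by rewrite mulf_eq0 invr_eq0 (negPf (sqrt_lam_neq0 l0))/= => /eqP.
Qed.

End eigenbasis_existence.

(** * The exploration measure and the features *)

Lemma Rintegral_sumr d (T : measurableType d) (R : realType)
    (mu : {measure set T -> \bar R}) (D : set T) (I : Type) (r : seq I) (F : I -> T -> R) :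
  measurable D -> (forall i, mu.-integrable D (EFin \o F i)) ->
  \int[mu]_(s in D) (\sum_(i <- r) F i s) = \sum_(i <- r) \int[mu]_(s in D) F i s.
Proof.
move=> mD iF; elim: r => [|i r IH].
  rewrite big_nil (@eq_Rintegral _ _ _ mu D (cst 0)); first by rewrite Rintegral_cst// mul0r.
  by move=> s _; rewrite big_nil.
rewrite big_cons -IH -RintegralD//.
  by apply: eq_Rintegral => s _; rewrite big_cons.
rewrite (_ : _ \o _ = (fun s => \sum_(j <- r) (F j s)%:E)%E); last first.
  by apply/funext => s /=; rewrite sumEFin.
by apply: integrable_sum => // j _; exact: iF.
Qed.

Section setting.
Context (R : realType) (J n0 : nat) (U : Type).
Variables (x : 'I_J -> R) (u : 'I_n0 -> U) (g : U -> R -> R -> R).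
Variable rho : {finite_measure set (measurableTypeR R) -> \bar R}.
Hypothesis hJ : (0 < J)%N.
Hypothesis hn0 : (0 < n0)%N.
Hypothesis hgL2 : forall k j, (fun s => \1_(unitI R) s * g (u k) (x j) s) \in
            Lfun (@lebesgue_measure R) 2%:E.
Hypothesis hgbd : exists C : R, forall k j s, unitI R s -> `|g (u k) (x j) s| <= C.
Hypothesis hZ : 0 < normZ x u g.
Hypothesis hrho : forall A : set (measurableTypeR R), measurable A ->
     rho A = (\int[lebesgue_measure]_(s in A) (rho_density x u g s)%:E)%E.
Local Notation lebesgue := (@lebesgue_measure R).
Local Notation dens := (rho_density x u g).
Local Notation Z := (normZ x u g).
Local Notation N := #|{: 'I_n0 * 'I_J}|.
Local Notation T := (measurableTypeR R).

Let Jpos : 0 < J%:R :> R. Proof. by rewrite ltr0n. Qed.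
Let npos : 0 < n0%:R :> R. Proof. by rewrite ltr0n. Qed.

(** The pair (k, j) is encoded by its rank in the enumeration of all pairs; the
    factor [\1_(unitI R)] cuts off values on which nothing is assumed. *)
Definition sample (i : 'I_N) (s : R) : R :=
  \1_(unitI R) s * g (u (enum_val i).1) (x (enum_val i).2) s.

Definition weight : R := Num.sqrt (n0%:R^-1 * J%:R^-1).

Lemma weight_gt0 : 0 < weight.
Proof. by rewrite sqrtr_gt0 mulr_gt0// invr_gt0. Qed.

Lemma weight_sqr : weight ^+ 2 = n0%:R^-1 * J%:R^-1.
Proof. by rewrite sqr_sqrtr// mulr_ge0// invr_ge0 ltW. Qed.

Lemma avg_sum (h : 'I_n0 -> 'I_J -> R) :
  avg (fun k => \sum_(j < J) h k j * J%:R^-1) =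
  \sum_(i < N) weight ^+ 2 * h (enum_val i).1 (enum_val i).2.
Proof.
rewrite /avg mulr_sumr.
rewrite -(big_enum_val (fun p : 'I_n0 * 'I_J => weight ^+ 2 * h p.1 p.2))/=.
rewrite (eq_bigl xpredT)// -(pair_bigA _ (fun k j => weight ^+ 2 * h k j))/=.
apply: eq_bigr => k _; rewrite mulr_sumr; apply: eq_bigr => j _.
by rewrite weight_sqr; ring.
Qed.

Lemma avg_mesh (h : 'I_n0 -> R -> R) :
  avg (fun k => mesh_int x (h k)) =
  \sum_(i < N) weight ^+ 2 * h (enum_val i).1 (x (enum_val i).2).
Proof. exact: avg_sum (fun k j => h k (x j)). Qed.

Lemma unitI_mesh s : unitI R s -> \1_(unitI R) s = 1 :> R.
Proof. by move=> Is; rewrite indicE mem_set. Qed.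

Lemma not_unitI s : ~ unitI R s -> \1_(unitI R) s = 0 :> R.
Proof. by move=> Is; rewrite indicE memNset. Qed.

Lemma densE s : dens s = Z^-1 * \sum_i weight ^+ 2 * `|sample i s|.
Proof.
rewrite /rho_density avg_mesh mulrCA; congr (_ * _); rewrite mulr_sumr.
apply: eq_bigr => i _; rewrite mulrCA /sample normrM [`|\1__ _|]ger0_norm//.
Qed.

Lemma dens_ge0 s : 0 <= dens s.
Proof.
rewrite densE; apply: mulr_ge0; first by rewrite invr_ge0 ltW.
by apply: sumr_ge0 => i _; rewrite mulr_ge0// sqr_ge0.
Qed.

Lemma sample_le_dens i s : weight ^+ 2 * `|sample i s| <= Z * dens s.
Proof.
rewrite densE mulVKf ?gt_eqF// (bigD1 i)//= lerDl sumr_ge0// => j _.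
by rewrite mulr_ge0// sqr_ge0.
Qed.

Lemma measurable_sample i : measurable_fun setT (sample i : T -> R).
Proof. exact: (@L2_measurable _ _ _ (@lebesgue_measure R) _ (hgL2 _ _)). Qed.

Lemma sample_bounded : exists C, forall i s, `|sample i s| <= C.
Proof.
have [C gC] := hgbd; exists (Num.max C 0) => i s; rewrite le_max.
have [Is|Is] := pselect (unitI R s).
  by rewrite /sample unitI_mesh// mul1r gC.
by rewrite /sample not_unitI// mul0r normr0 lexx orbT.
Qed.

Lemma measurable_dens : measurable_fun setT (dens : T -> R).
Proof.
rewrite (_ : dens = fun s => Z^-1 * \sum_i weight ^+ 2 * `|sample i s|); last first.
  by apply/funext => s; exact: densE.
apply: measurable_funM => //; apply: measurable_sum => i.
apply: measurable_funM => //; apply: measurableT_comp => //.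
exact: measurable_sample.
Qed.

Lemma dens_bounded : exists M, forall s, dens s <= M.
Proof.
have [C gC] := sample_bounded.
exists (Z^-1 * \sum_(i < N) weight ^+ 2 * C) => s.
rewrite densE; apply: ler_wpM2l; first by rewrite invr_ge0 ltW.
apply: ler_sum => i _.
by rewrite ler_wpM2l ?sqr_ge0.
Qed.

Lemma rho_le_lebesgue : exists M : R, forall A : set T, measurable A ->
  (rho A <= M%:E * lebesgue A)%E.
Proof.
have [M dM] := dens_bounded; exists M => A mA.
rewrite hrho// -integral_cst//; apply: ge0_le_integral => //.
- by move=> s _; rewrite lee_fin dens_ge0.
- by apply/measurable_EFinP; apply: measurable_funTS; exact: measurable_dens.
- by move=> s _; rewrite lee_fin.
Qed.

Lemma lebesgue_unitI : lebesgue (unitI R) = 1%E.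
Proof. by rewrite /unitI lebesgue_measure_itv/= lte_fin ltr01 oppr0 adde0. Qed.

Lemma bounded_integrable_unitI (f : T -> R) (C : R) : measurable_fun setT f ->
  (forall s, `|f s| <= C) -> lebesgue.-integrable (unitI R) (EFin \o f).
Proof.
move=> mf fC; apply: measurable_bounded_integrable.
- exact: measurable_itv.
- by apply: (@le_lt_trans _ _ 1%E); rewrite ?ltry//; have := lebesgue_unitI; move=> /= ->.
- exact: measurable_funTS.
- exists C; split; first exact: num_real.
  by move=> y Cy s _ /=; exact: le_trans (fC s) (ltW Cy).
Qed.

(** The constant Z was chosen for this: integrating the density exchanges the
    integral with the averages. *)
Lemma rho_unitI : rho (unitI R) = 1%E.
Proof.
have [C gC] := sample_bounded.
have mg i : measurable_fun setT ((fun s => `|sample i s|) : T -> R).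
  by apply: measurableT_comp => //; exact: measurable_sample.
have ig i : lebesgue.-integrable (unitI R) (EFin \o (fun s => `|sample i s|)).
  by apply: (@bounded_integrable_unitI _ C) => // s; rewrite normr_id.
have igw i : lebesgue.-integrable (unitI R)
    (EFin \o (fun s => weight ^+ 2 * `|sample i s|)).
  apply: (@bounded_integrable_unitI _ (weight ^+ 2 * C)).
    exact: measurable_funM.
  by move=> s; rewrite normrM normr_id ger0_norm ?sqr_ge0// ler_wpM2l ?sqr_ge0.
have mI : measurable (unitI R : set T) by exact: measurable_itv.
have ZE : Z = \sum_i weight ^+ 2 * \int[lebesgue]_(s in unitI R) `|sample i s|.
  rewrite -(avg_sum (fun k j => \int[lebesgue]_(s in unitI R)
    `|\1_(unitI R) s * g (u k) (x j) s|)).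
  rewrite /normZ; congr avg; apply/funext => k.
  have igk j : lebesgue.-integrable (unitI R)
      (EFin \o (fun s => `|\1_(unitI R) s * g (u k) (x j) s|)).
    by have := ig (enum_rank (k, j)); rewrite /sample enum_rankK.
  under [RHS]eq_bigr => j _ do rewrite -RintegralZr//.
  rewrite -Rintegral_sumr//; last first.
    move=> j; have := integrableZr mI (J%:R^-1) (igk j).
    by apply: eq_integrable => // s _ /=; rewrite EFinM.
  apply: eq_Rintegral => s; rewrite inE => Is.
  by apply: eq_bigr => j _; rewrite unitI_mesh// mul1r.
rewrite hrho//.
have Edens : (\int[lebesgue]_(s in unitI R) (dens s)%:E =
   (\int[lebesgue]_(s in unitI R) dens s)%:E)%E.
  have [M dM] := dens_bounded.
  rewrite /Rintegral fineK//; apply: integrable_fin_num => //.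
  apply: (@bounded_integrable_unitI _ M); first exact: measurable_dens.
  by move=> s; rewrite ger0_norm ?dens_ge0.
rewrite Edens; congr EFin.
under eq_Rintegral do rewrite densE.
rewrite RintegralZl//; last first.
  rewrite (_ : _ \o _ = (fun s => \sum_i (weight ^+ 2 * `|sample i s|)%:E)%E); last first.
    by apply/funext => s /=; rewrite sumEFin.
  by apply: integrable_sum => // i _; exact: igw.
rewrite Rintegral_sumr// (eq_bigr (fun i => weight ^+ 2 *
    \int[lebesgue]_(s in unitI R) `|sample i s|)); last first.
  by move=> i _; rewrite RintegralZl.
by rewrite -ZE mulVf// gt_eqF.
Qed.

Lemma rho_itv : (0 < rho `]0%R, 1%R]%classic)%E.
Proof.
have E : unitI R = [set 0] `|` `]0%R, 1%R]%classic.
  by rewrite /unitI -(@setU1itv _ _ (BRight 1) 0 false)// bnd_simp.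
have [M rM] := rho_le_lebesgue.
have m0 : measurable ([set 0] : set T) by exact: measurable_set1.
have r0 : rho [set 0] = 0%E.
  by apply/eqP; rewrite -measure_le0 (le_trans (rM _ m0))// lebesgue_measure_set1 mule0.
have m01 : measurable (`]0%R, 1%R]%classic : set T) by exact: measurable_itv.
rewrite lt0e measure_ge0 andbT; apply/eqP => r1.
have := rho_unitI; rewrite E => r01.
pose B := `]0%R, 1%R]%classic : set T; rewrite -/B in m01 r1 r01.
have h : (rho ([set 0%R] `|` B) <= rho [set 0%R] + rho B)%E := measureU2 rho m0 m01.
by move: h; rewrite r01 r0 r1 adde0 lee_fin ler10.
Qed.

(** The quotient is 0 where the density vanishes. *)
Definition feature (i : 'I_N) (s : R) : R := weight * sample i s / dens s.

Lemma feature_out i s : ~ unitI R s -> feature i s = 0.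
Proof. by move=> Is; rewrite /feature /sample not_unitI// mul0r mulr0 mul0r. Qed.

(** Where the density vanishes, so do all samples. *)
Lemma feature_dens i s : feature i s * dens s = weight * sample i s.
Proof.
have [d0|d0] := eqVneq (dens s) 0; last by rewrite /feature divfK.
have := sample_le_dens i s; rewrite d0 !mulr0 => g0.
have -> : sample i s = 0; last by rewrite mulr0.
apply/eqP; rewrite -normr_eq0 eq_le normr_ge0 andbT.
by rewrite -(pmulr_rle0 _ (exprn_gt0 2 weight_gt0)).
Qed.

Lemma feature_bounded : exists C, forall i s, `|feature i s| <= C.
Proof.
exists (Z / weight) => i s.
have Zw : 0 <= Z / weight by rewrite divr_ge0 ?ltW// weight_gt0.
have [d0|d0] := eqVneq (dens s) 0; first by rewrite /feature d0 invr0 mulr0 normr0.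
have dp : 0 < dens s by rewrite lt_def d0 dens_ge0.
rewrite -(ler_pM2r dp) -{1}(gtr0_norm dp) -normrM feature_dens normrM.
rewrite (gtr0_norm weight_gt0) -(ler_pM2l weight_gt0) mulrA -expr2.
rewrite (_ : weight * (Z / weight * dens s) = Z * dens s); first exact: sample_le_dens.
by field; rewrite gt_eqF// weight_gt0.
Qed.

Lemma measurable_feature i : measurable_fun setT (feature i : T -> R).
Proof.
rewrite (_ : feature i = fun s => weight * sample i s * (dens s) `^ (-1)); last first.
  by apply/funext => s; rewrite powR_inv1 ?dens_ge0.
apply: measurable_funM.
  by apply: measurable_funM => //; exact: measurable_sample.
apply: (measurableT_comp (measurable_powR _)); exact: measurable_dens.
Qed.

Lemma L2_feature i : L2 rho (feature i).
Proof.
have [C fC] := feature_bounded.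
apply: (@L2_bounded _ _ _ _ _ C) => //; first exact: fin_num_measure.
exact: measurable_feature.
Qed.

Lemma Gbar_feature s t : Gbar x u g s t = kernel_of feature s t.
Proof.
rewrite /Gbar /kernel_of; case: ifPn => [dd|dd].
  have [ds dt] : dens s != 0 /\ dens t != 0.
    by split; apply: contra_ltN dd => /eqP ->; rewrite ?mul0r ?mulr0.
  have Is : unitI R s.
    by apply: contrapT => Is; move: ds; rewrite /rho_density not_unitI// mul0r eqxx.
  have It : unitI R t.
    by apply: contrapT => It; move: dt; rewrite /rho_density not_unitI// mul0r eqxx.
  rewrite /G avg_mesh mulr_suml; apply: eq_bigr => i _.
  by rewrite /feature /sample !unitI_mesh// !mul1r; field; rewrite ds dt.
rewrite big1// => i _; have [d0|d0] := eqVneq (dens s) 0.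
  by rewrite /feature d0 invr0 mulr0 mul0r.
have d1 : dens t = 0.
  apply/eqP; rewrite eq_le dens_ge0 andbT.
  by move: dd; rewrite -leNgt pmulr_rle0// lt_def d0 dens_ge0.
by rewrite /feature d1 invr0 !mulr0.
Qed.

Lemma Gbar_L2 : (fun z => Gbar x u g z.1 z.2) \in Lfun (rho \x rho)%E 2%:E.
Proof.
have [C fC] := feature_bounded.
rewrite (_ : (fun z => _) = (fun z => \sum_i feature i z.1 * feature i z.2)); last first.
  by apply/funext => z; rewrite Gbar_feature.
have C0 : 0 <= C.
  have i0 : 'I_N by apply: (@enum_rank {: 'I_n0 * 'I_J} (Ordinal hn0, Ordinal hJ)).
  by rewrite (le_trans _ (fC i0 0)).
apply: (@L2_bounded _ _ _ _ _ (\sum_(i < N) C * C)).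
- have := product_measure1E rho rho (@measurableT _ T) (@measurableT _ T).
  rewrite setXTT /= => ->.
  by apply: fin_numM; exact: fin_num_measure.
- apply: measurable_sum => i; apply: measurable_funM.
    exact: measurableT_comp (measurable_feature i) (@measurable_fst _ _ _ _).
  exact: measurableT_comp (measurable_feature i) (@measurable_snd _ _ _ _).
- move=> z; apply: le_trans (ler_norm_sum _ _ _) _.
  by apply: ler_sum => i _; rewrite normrM ler_pM.
Qed.

Lemma LG_finite_rank N' (a : 'I_N' -> R -> R) phi : (forall i, L2 rho (a i)) ->
  (forall s t, Gbar x u g s t = kernel_of a s t) -> L2 rho phi ->
  LG x u g rho phi = comb (fun i => L2_dot rho phi (a i)) a.
Proof.
move=> La aE Lphi; apply/funext => s; rewrite /LG combE.
have E : \int[rho]_t (phi t * Gbar x u g s t) =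
    \int[rho]_t (\sum_i a i s * (phi t * a i t)).
  apply: eq_Rintegral => t _; rewrite aE /kernel_of mulr_sumr.
  by apply: eq_bigr => i _; rewrite mulrCA.
rewrite E Rintegral_sumr//; last first.
  move=> i; have := integrableZl measurableT (a i s) (L2_integrableM Lphi (La i)).
  by apply: eq_integrable => // t _ /=; rewrite EFinM.
apply: eq_bigr => i _; rewrite mulrC (@RintegralZl _ _ _ rho)//.
exact: L2_integrableM.
Qed.

Lemma rho_dominated : rho `<< lebesgue.
Proof.
have [M rM] := rho_le_lebesgue.
apply/null_content_dominatesP => A mA A0.
by apply/eqP; rewrite -measure_le0 (le_trans (rM _ mA))// A0 mule0.
Qed.

(** The density agrees almost everywhere with the Radon-Nikodym derivative of [rho],
    because both have the same integrals. *)
Lemma Rintegral_density (f : T -> R) : rho.-integrable setT (EFin \o f) ->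
  \int[rho]_s f s = \int[lebesgue]_s (f s * dens s).
Proof.
move=> rf; rewrite /Rintegral; congr fine.
rewrite -(Radon_Nikodym_change_of_variables rho_dominated measurableT rf).
have iRN := @Radon_Nikodym_integrable _ _ _ (charge_of_finite_measure rho) lebesgue rho_dominated.
have mf : measurable_fun setT f by apply/measurable_EFinP; exact: measurable_int rf.
have mdens := measurable_dens.
have RNdens : ae_eq lebesgue setT
    (Radon_Nikodym (charge_of_finite_measure rho) lebesgue) (EFin \o dens).
  apply: integral_ae_eq => //; first exact/measurable_EFinP.
  by move=> A _ mA; rewrite -Radon_Nikodym_integral//; [exact: hrho|exact: rho_dominated].
apply: ae_eq_integral => //.
- by apply: emeasurable_funM; [exact/measurable_EFinP|exact: measurable_int iRN].
- by apply/measurable_EFinP; exact: measurable_funM.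
- by apply: filterS RNdens => s /(_ I) -> _.
Qed.

(** On [0, 1], [phi s * g s] is [weight^-1 * phi s * feature s] times the density. *)
Lemma Rop_feature phi i : L2 rho phi ->
  weight * Rop g phi (u (enum_val i).1) (x (enum_val i).2) = L2_dot rho phi (feature i).
Proof.
move=> Lphi; have iphi := L2_integrableM Lphi (L2_feature i).
have w0 : weight != 0 by rewrite gt_eqF ?weight_gt0.
have iw : rho.-integrable setT (EFin \o (fun s => phi s * feature i s * weight^-1)).
  have := integrableZr measurableT (weight^-1) iphi.
  by apply: eq_integrable => // s _ /=; rewrite EFinM.
have -> : L2_dot rho phi (feature i) =
    weight * \int[rho]_s (phi s * feature i s * weight^-1).
  by rewrite (@RintegralZr _ _ _ rho)// mulrCA mulfV// mulr1.
congr (_ * _); rewrite Rintegral_density// /Rop Rintegral_mkcond.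
apply: eq_Rintegral => s _; rewrite patchE.
have -> : phi s * feature i s / weight * dens s = phi s * sample i s.
  rewrite -[RHS]mulr1 -(mulVf w0) -mulrA [_ * dens s]mulrC mulrA -[_ * _ * dens s]mulrA.
  by rewrite feature_dens; field.
rewrite /sample; case: ifPn => Is.
  by rewrite unitI_mesh ?mul1r//; exact: set_mem.
by rewrite not_unitI ?mul0r ?mulr0//; move=> /mem_set; apply/negP.
Qed.

Section data.
Variable f : 'I_n0 -> R -> R.

Definition datum (i : 'I_N) : R := f (enum_val i).1 (x (enum_val i).2).

Definition data_repr : R -> R := comb (fun i => weight * datum i) feature.

Lemma data_pairing phi : L2 rho phi ->
  avg (fun k => mesh_int x (fun y => Rop g phi (u k) y * f k y)) =
  \sum_i weight * datum i * L2_dot rho phi (feature i).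
Proof.
move=> Lphi; rewrite avg_mesh; apply: eq_bigr => i _.
by rewrite -Rop_feature// /datum; ring.
Qed.

Lemma data_reprP : riesz_representer x u g rho f data_repr.
Proof.
have LF := L2_feature; split; first exact: L2_comb.
move=> phi Lphi; rewrite data_pairing// L2_dot_comb//.
by apply: eq_bigr => i _; rewrite [L2_dot rho (feature i) _]L2_dotC.
Qed.

Lemma riesz_representer_unique phiD psi : riesz_representer x u g rho f phiD ->
  L2 rho psi ->
  (forall phi, L2 rho phi -> L2_dot rho psi phi =
     avg (fun k => mesh_int x (fun y => Rop g phi (u k) y * f k y))) ->
  phiD = psi %[ae rho].
Proof.
move=> [LD DE] Lpsi psiE; have LB := L2B LD Lpsi.
by apply/(L2_ae_eqP LD Lpsi); rewrite L2_dotBl// DE// psiE// subrr.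
Qed.

(** By [Rop_feature] the loss is the sum of the squares of
    [<< phi, feature i >> - weight * datum i]. *)
Lemma loss_quadratic phiD phi : riesz_representer x u g rho f phiD -> L2 rho phi ->
  loss x u g f phi = L2_dot rho (LG x u g rho phi) phi - 2 * L2_dot rho phiD phi
    + \sum_i (weight * datum i) ^+ 2.
Proof.
move=> [_ DE] Lphi; have LF := L2_feature.
rewrite DE// data_pairing// (LG_finite_rank LF Gbar_feature Lphi) L2_dot_comb//.
rewrite /loss avg_mesh mulr_sumr -sumrB -big_split; apply: eq_bigr => i _ /=.
rewrite real_normK ?num_real// -/(datum i) [L2_dot rho (feature i) _]L2_dotC.
by rewrite -Rop_feature//; ring.
Qed.

Lemma noiseless_repr phistar phiD :
  (forall k j, f k (x j) = Rop g phistar (u k) (x j)) -> L2 rho phistar ->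
  riesz_representer x u g rho f phiD -> phiD = LG x u g rho phistar %[ae rho].
Proof.
move=> fE Ls rD; have LF := L2_feature; rewrite (LG_finite_rank LF Gbar_feature Ls).
apply: (riesz_representer_unique rD); first exact: L2_comb.
move=> phi Lphi; rewrite data_pairing// L2_dot_comb//; apply: eq_bigr => i _.
by rewrite /datum fE (Rop_feature i Ls); congr (_ * _); exact: L2_dotC.
Qed.

End data.
End setting.

(** * The automatic reproducing kernel *)

Theorem lemma2p4 (R : realType) (J n0 : nat) (U : Type)
  (x : 'I_J -> R) (u : 'I_n0 -> U) (g : U -> R -> R -> R)
  (rho : {finite_measure set (measurableTypeR R) -> \bar R})
  (phistar : R -> R) (eps f : 'I_n0 -> R -> R)
  (hJ : (0 < J)%N) (hn0 : (0 < n0)%N)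
  (hx : uniform_mesh x)
  (hgL2 : forall k j, (fun s => \1_(unitI R) s * g (u k) (x j) s) \in
            Lfun (@lebesgue_measure R) 2%:E)
  (hgbd : exists C : R, forall k j s, unitI R s -> `|g (u k) (x j) s| <= C)
  (hZ : 0 < normZ x u g)
  (hrho : forall A : set (measurableTypeR R), measurable A ->
     rho A =
     (\int[lebesgue_measure]_(s in A) (rho_density x u g s)%:E)%E)
  (hf : forall k j, f k (x j) = Rop g phistar (u k) (x j) + eps k (x j)) :
  let L := LG x u g rho in
  let H := L2_orth rho (null_space rho L) in
  (* (a) *)
  [/\ (fun z => Gbar x u g z.1 z.2) \in Lfun (rho \x rho)%E 2%:E,
      (forall s s', Gbar x u g s s' = Gbar x u g s' s),
      [/\ bounded_operator rho L, compact_operator rho L,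
          self_adjoint rho L & positive_operator rho L],
      (forall (lam : R) psi, L2 rho psi ->
         ~ psi = (0 : R -> R) %[ae rho] ->
         L psi = lam *: psi %[ae rho] -> 0 <= lam) &
      exists lam psi, eigenbasis rho L lam psi] /\
  (* (b) *)
  [/\ (exists phiD, [/\ riesz_representer x u g rho f phiD,
         (forall phiD', riesz_representer x u g rho f phiD' ->
            phiD' = phiD %[ae rho]) &
         exists c : R, forall phi, L2 rho phi ->
           loss x u g f phi =
           L2_dot rho (L phi) phi - 2 * L2_dot rho phiD phi + c]),
      (forall lam psi, eigenbasis rho L lam psi ->
         L2_closure rho
           (lin_span [set psi i | i in [set i | 0 < lam i]]) = H) &
      ((forall k j, eps k (x j) = 0) -> L2 rho phistar ->
       forall phiD, riesz_representer x u g rho f phiD ->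
       phiD = L phistar %[ae rho] /\
       exists phihat,
         [/\ H phihat,
             (forall psi, H psi -> loss x u g f phihat <= loss x u g f psi),
             (forall phi, H phi ->
                (forall psi, H psi -> loss x u g f phi <= loss x u g f psi) ->
                phi = phihat %[ae rho]),
             restr_inverse rho L H phiD phihat &
             orth_proj_of rho H phistar phihat])] /\
  (* (c) *)
  exists Lh, [/\ sqrt_operator rho L Lh,
    (forall Lh', sqrt_operator rho L Lh' ->
       forall phi, L2 rho phi -> Lh' phi = Lh phi %[ae rho]),
    H = L2_closure rho (L2_range rho Lh),
    (exists V ip, is_rkhs (unitI R) (Gbar x u g) V ip) &
    forall V ip, is_rkhs (unitI R) (Gbar x u g) V ip ->
      [/\ V `<=` L2 rho,
          rkhs_image rho V = L2_range rho Lh,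
          (forall phi, L2_range rho Lh phi ->
             exists2 h, restr_inverse rho Lh H phi h &
               quot_norm rho V ip phi ^+ 2 = L2_dot rho h h),
          (forall phi psi h k,
             restr_inverse rho Lh H phi h -> restr_inverse rho Lh H psi k ->
             L2_range rho Lh phi -> L2_range rho Lh psi ->
             quot_dot rho V ip phi psi = L2_dot rho h k) &
          (forall phi psi, L2_range rho Lh phi -> L2 rho psi ->
             quot_dot rho V ip phi (L psi) = L2_dot rho phi psi)]].
Proof.
move=> L H.
pose F := feature x u g.
have LF i : L2 rho (F i) by exact: (L2_feature rho hJ hn0 hgL2 hZ).
have GF := Gbar_feature hZ.
(* Functions of this class vanish off [0, 1], as required of members of the
reproducing kernel space. *)
pose S : set (R -> R) := [set h | L2 rho h /\ forall s, ~ unitI R s -> h s = 0].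
have S_submod : submod S.
  split; first by split; [exact: L2_0|].
  move=> c h k [Lh h0] [Lk k0]; split; first exact: L2_lin.
  by move=> s Is; rewrite !fctE h0// k0// scaler0 addr0.
have SF i : S (F i) by split=> // s; exact: feature_out.
have SL : S `<=` L2 rho by move=> h [].
have [N [b [Sb bk bo ib]]] :=
  @kernel_decomposition _ (measurableTypeR R) R rho S _ F S_submod SL SF.
have Lb i : L2 rho (b i) := (Sb i).1.
have Gb s t : Gbar x u g s t = kernel_of b s t by rewrite GF bk.
have LE phi : L2 rho phi -> L phi = diag_op rho b (fun=> 1) phi.
  move=> Lphi; rewrite /L (LG_finite_rank Lb Gb Lphi).
  by congr comb; apply/funext => p; rewrite mul1r.
have [M rM] := rho_le_lebesgue hgL2 hgbd hZ hrho.
have r01 := rho_itv hgL2 hgbd hZ hrho.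
split; [split|split; [split|]].
- exact: Gbar_L2.
- by move=> s t; rewrite !Gb /kernel_of; apply: eq_bigr => i _; rewrite mulrC.
- split; [exact: diag_bounded LE|exact: diag_compact LE|exact: diag_self_adjoint LE|].
  exact: L_positive LE.
- by move=> lam psi; exact: (eigenvalue_ge0 Lb LE).
- apply: (eigenbasis_exists Lb bo LE (L2_ray rho)).
    by move=> h e Lh e0; exact: (rays_total rM).
  by move=> s; exact: (L2_infinite_dim rM).
- exists (data_repr x u g f).
  have rD := data_reprP hJ hn0 hgL2 hgbd hZ hrho f.
  split => //.
    by move=> phiD' rD'; apply: (riesz_representer_unique rD'); case: rD.
  exists (\sum_i (weight R J n0 * datum x f i) ^+ 2) => phi Lphi.
  exact: loss_quadratic.
- by move=> lam psi; exact: (eigenbasis_closure Lb LE).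
- move=> eps0 Ls phiD rD.
  have fE k j : f k (x j) = Rop g phistar (u k) (x j) by rewrite hf eps0 addr0.
  have DE : phiD = L phistar %[ae rho].
    exact: (noiseless_repr hJ hn0 hgL2 hgbd hZ hrho fE).
  split => //; eexists.
  apply: (quadratic_minimizer Lb bo LE Ls rD.1 DE) => phi Lphi.
  exact: (loss_quadratic hJ hn0 hgL2 hgbd hZ hrho rD Lphi).
- pose Lsqrt := diag_op rho b (fun p => (Num.sqrt (L2_dot rho (b p) (b p)))^-1).
  have HE := H_range_sqrt Lb bo LE; have bD i s : ~ unitI R s -> b i s = 0 := (Sb i).2 s.
  exists Lsqrt; split.
  + exact: sqrt_diag.
  + by move=> Lh' sLh' phi Lphi; exact: (sqrt_unique Lb bo LE).
  + by rewrite -HE L2_orth_closed// => h [].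
  + by do 2!eexists; exact: comb_space_rkhs Gb bD ib.
  + by move=> V ip rkhs; exact: (rkhs_classes_sqrt Lb bo LE Gb bD ib rkhs).
Qed.
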